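(* Let $k,n\ge 1$ be integers, let $0<\alpha<n$ and $0<\gamma<\min\big(\frac{k}{n-\alpha},1\big)$, and let $\varrho>0$. (i) There is some $X^\ast\in\mathcal{B}^\gamma_\varrho$ minimizing the functional $X\mapsto I^\alpha(\mu_X)$ over $\mathcal{B}^\gamma_\varrho$. (ii) For any minimizer $X^\ast$ of $X\mapsto I^\alpha(\mu_X)$ in $\mathcal{B}^\gamma_\varrho$ and any rectangle $\mathcal{R}\subset[0,1]^k$ the image $X^\ast(\mathcal{R})$ satisfies $$\mathcal{H}^{n-\alpha}(X^\ast(\mathcal{R}))=+\infty,\qquad \mathcal{H}^{\min(k/\gamma,\,n)}(X^\ast(\mathcal{R}))<+\infty,$$ and, as a consequence, $$n-\alpha\le \dim_H X^\ast(\mathcal{R})\le \min\Big(\frac{k}{\gamma},n\Big).$$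
   Context: For $X:[0,1]^k\to\mathbb{R}^n$ Borel, the occupation measure is $\mu_X(B)=\mathcal{L}^k(\{t\in[0,1]^k: X(t)\in B\})$, $B\subset\mathbb{R}^n$ Borel. For $0<\alpha<n$ and a nonnegative Radon measure $\mu$ on $\mathbb{R}^n$, the Riesz energy of order $\alpha$ is $I^\alpha(\mu)=\int_{\mathbb{R}^n}\int_{\mathbb{R}^n}|x-y|^{\alpha-n}\mu(dy)\mu(dx)\in[0,+\infty]$; thus $I^\alpha(\mu_X)=\int_{[0,1]^k}\int_{[0,1]^k}|X(t)-X(s)|^{\alpha-n}\,ds\,dt$. For $\gamma\in(0,1)$, $\mathcal{C}_0^\gamma([0,1]^k,\mathbb{R}^n)$ is the space of functions $X:[0,1]^k\to\mathbb{R}^n$ with $X(0)=0$ and $\|X\|_{\mathcal{C}_0^\gamma}:=\sup_{s\ne t}\frac{|X(t)-X(s)|}{|t-s|^\gamma}<+\infty$, and $\mathcal{B}^\gamma_\varrho:=\{X\in\mathcal{C}_0^\gamma([0,1]^k,\mathbb{R}^n):\|X\|_{\mathcal{C}_0^\gamma}\le\varrho\}$. $\mathcal{H}^s$ is $s$-dimensional Hausdorff measure and $\dim_H$ is Hausdorff dimension. Rectangles are nondegenerate, i.e. products of $k$ intervals of positive length. *)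

(* Defs.v *)
From HB Require Import structures.
From mathcomp Require Import all_boot all_order all_algebra.
From mathcomp Require Import all_classical all_reals all_analysis.
From mathcomp Require Import measurable_realfun.

Set Implicit Arguments.
Unset Strict Implicit.
Unset Printing Implicit Defensive.

Import Order.TTheory GRing.Theory Num.Theory.
Import numFieldNormedType.Exports.

Local Open Scope classical_set_scope.
Local Open Scope ring_scope.

(* Convertible to 'rV[R]_n. *)
Definition borel_rV (R : realType) (n : nat) : measurableType _ :=
  g_sigma_algebraType (@open 'rV[R]_n).

Section lebesgue_step.
Variables (R : realType) (k : nat).

Definition cons_rV (p : R * borel_rV R k) : borel_rV R k.+1 :=
  (\row_i if unlift ord0 i is Some j then (p.2 : 'rV[R]_k) ord0 j else p.1)
  : 'rV[R]_k.+1.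

Definition uncons_rV (v : borel_rV R k.+1) : R * borel_rV R k :=
  ((v : 'rV[R]_k.+1) ord0 ord0,
   (\row_i (v : 'rV[R]_k.+1) ord0 (lift ord0 i)) : 'rV[R]_k).

Lemma cons_rV0 p : (cons_rV p : 'rV[R]_k.+1) ord0 ord0 = p.1.
Proof. by rewrite mxE unlift_none. Qed.

Lemma cons_rVS p (i : 'I_k) :
  (cons_rV p : 'rV[R]_k.+1) ord0 (lift ord0 i) = (p.2 : 'rV[R]_k) ord0 i.
Proof. by rewrite mxE liftK. Qed.

Lemma cons_rVK : cancel cons_rV uncons_rV.
Proof.
move=> [x v]; rewrite /uncons_rV cons_rV0; congr pair.
by apply/rowP => i; rewrite mxE cons_rVS.
Qed.

Lemma cons_rV_ball (q : 'rV[R]_k.+1) (e : R) :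
  cons_rV @^-1` ball q e =
  ball (q ord0 ord0) e `*` ball (\row_i q ord0 (lift ord0 i) : 'rV[R]_k) e.
Proof.
apply/seteqP; split => [p [e0 h]|p [h0 [e0 h]]].
- split; first by have := h ord0 ord0; rewrite cons_rV0.
  split => // i j; rewrite !ord1 mxE.
  by have := h ord0 (lift ord0 j); rewrite cons_rVS.
- split => // i j; rewrite !ord1.
  case: (unliftP ord0 j) => [j' ->|->]; last by rewrite cons_rV0.
  by rewrite cons_rVS; have := h ord0 j'; rewrite mxE.
Qed.

Lemma measurable_cons_rV : measurable_fun setT cons_rV.
Proof.
pose P : measurableType _ := (R * borel_rV R k)%type.
apply: (@measurability _ _ P (borel_rV R k.+1) setT cons_rV (@open _) erefl).
move=> _ [U oU <-]; rewrite setTI.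
pose c (x : 'rV[rat]_k.+1 * rat) : set 'rV[R]_k.+1 :=
  ball (map_mx (@ratr R) x.1) (ratr x.2).
have UE : U = \bigcup_x (if `[< c x `<=` U >] then c x else set0).
  apply/seteqP; split => [u Uu|u [x _]]; last first.
    by case: ifPn => [/asboolP|//]; exact.
  have /nbhs_ballP[e /= e0 eU] : nbhs u U by exact: open_nbhs_nbhs.
  have [r /= r0 re] : exists2 r : rat, 0 < ratr r :> R & ratr r < e / 2 :> R.
    have [|r] := @rat_in_itvoo R 0 (e / 2); first by rewrite divr_gt0.
    by rewrite in_itv/= => /andP[? ?]; exists r.
  have qP (i : 'I_k.+1) : exists q : rat, ball (u ord0 i) (ratr r) (ratr q : R).
    have [|q] := @rat_in_itvoo R (u ord0 i - ratr r) (u ord0 i + ratr r).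
      by rewrite ltrD2l gt0_cp.
    rewrite in_itv/= => /andP[? ?]; exists q.
    by rewrite /ball/= ltr_distlC; apply/andP.
  have [q qu] := choice qP.
  have uq : ball u (ratr r) (map_mx (@ratr R) (\row_i q i)).
    by split => // i j; rewrite !ord1 !mxE; exact: qu.
  exists (\row_i q i, r) => //; rewrite asboolT; first exact: ball_sym.
  move=> v /= cv; apply: eU; apply: (@le_ball _ _ _ (ratr r + ratr r)).
    by rewrite [leRHS]splitr ltW// ltrD.
  exact: ball_triangle uq cv.
rewrite UE preimage_bigcup; apply: countable_bigcupT_measurable => [|x].
  exact: countableP.
case: ifPn => _; last by rewrite preimage_set0.
rewrite /c cons_rV_ball.
have [e0|e0] := ltP 0 (ratr x.2 : R); last first.
  rewrite (_ : _ `*` _ = set0); first exact: measurable0.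
  by rewrite -subset0 => y [_ [/lt_geF]]; rewrite e0.
apply: measurableX; first by apply: open_measurable; exact: ball_open.
by apply: sub_sigma_algebra; exact: ball_open.
Qed.

Lemma measurable_uncons_rV : measurable_fun setT uncons_rV.
Proof.
apply/measurable_fun_pairP; split.
- apply: (measurability _ (RGenOpens.measurableE R)).
  move=> _ [_ [a [b ->]] <-]; rewrite setTI; apply: sub_sigma_algebra.
  apply: (@open_comp 'rV[R]_k.+1 R (fun v => v ord0 ord0)) => [v _|].
    exact: coord_continuous.
  exact: interval_open.
- apply: (@measurability _ _ (borel_rV R k.+1) (borel_rV R k) setT _ (@open _)
    erefl).
  move=> _ [U oU <-]; rewrite setTI; apply: sub_sigma_algebra.
  apply: (@open_comp 'rV[R]_k.+1 'rV[R]_k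
    (fun v => \row_i v ord0 (lift ord0 i))) => // v _.
  move=> B /nbhs_ballP[e /= e0 eB]; apply/nbhs_ballP; exists e => //= w [_ vw].
  by apply: eB; split => // i j; rewrite !mxE; exact: vw.
Qed.

Variable m : {sigma_finite_measure set (borel_rV R k) -> \bar R}.

Definition lebesgue_step : set (borel_rV R k.+1) -> \bar R :=
  pushforward (lebesgue_measure \x m)%E cons_rV.

Let lebesgue_step0 : lebesgue_step set0 = 0%E.
Proof. by rewrite /lebesgue_step /pushforward preimage_set0 measure0. Qed.

Let lebesgue_step_ge0 A : (0 <= lebesgue_step A)%E.
Proof. by rewrite /lebesgue_step /pushforward; exact: measure_ge0. Qed.

Let lebesgue_step_sigma_additive : semi_sigma_additive lebesgue_step.
Proof.
have mc A : measurable A -> measurable (cons_rV @^-1` A).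
  by move=> mA; rewrite -[X in measurable X]setTI; exact: measurable_cons_rV.
move=> F mF tF mUF; rewrite /lebesgue_step /pushforward preimage_bigcup.
apply: measure_semi_sigma_additive.
- by move=> i; exact: mc.
- apply/trivIsetP => /= i j _ _ ij; rewrite -preimage_setI.
  by move/trivIsetP : tF => ->//; rewrite preimage_set0.
- by rewrite -preimage_bigcup; exact: mc.
Qed.

HB.instance Definition _ := isMeasure.Build _ _ _ lebesgue_step
  lebesgue_step0 lebesgue_step_ge0 lebesgue_step_sigma_additive.

Let lebesgue_step_sigma_finite : sigma_finite setT lebesgue_step.
Proof.
have /sigma_finiteP[F [FT ndF Foo]] := sigma_finiteT (@lebesgue_measure R).
have /sigma_finiteP[G [GT ndG Goo]] := sigma_finiteT m.
exists (fun i => uncons_rV @^-1` (F i `*` G i)).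
  rewrite -preimage_bigcup (_ : \bigcup_i _ = setT) ?preimage_setT//.
  rewrite -setXTT FT GT predeqE => -[x y]; split.
    by move=> [i _ []/= ? ?]; split; exists i.
  move=> [/= [i _ Fx] [j _ Gy]]; exists (maxn i j) => //; split.
  - by move: x Fx; exact/subsetPset/ndF/leq_maxl.
  - by move: y Gy; exact/subsetPset/ndG/leq_maxr.
move=> i; have [mF Fi] := Foo i; have [mG Gi] := Goo i; split.
  rewrite -[X in measurable X]setTI; apply: measurable_uncons_rV => //.
  exact: measurableX.
rewrite /lebesgue_step /pushforward -comp_preimage.
rewrite (_ : uncons_rV \o cons_rV = id); last first.
  by rewrite funeqE => p; exact: cons_rVK.
by rewrite preimage_id product_measure1E// lte_mul_pinfty// ge0_fin_numE.
Qed.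

HB.instance Definition _ := Measure_isSigmaFinite.Build _ _ _ lebesgue_step
  lebesgue_step_sigma_finite.

End lebesgue_step.

(* The k-fold product of the Lebesgue measure on the line, see lebesgue_rV_box;
   the Dirac mass at the unique point when k = 0. *)
Fixpoint lebesgue_rV (R : realType) (k : nat) :
    {sigma_finite_measure set (borel_rV R k) -> \bar R} :=
  match k return {sigma_finite_measure set (borel_rV R k) -> \bar R} with
  | 0 => @dirac _ (borel_rV R 0) (0 : 'rV[R]_0) R
  | k'.+1 => lebesgue_step (lebesgue_rV R k')
  end.

(* A product of k intervals of any kind (open, closed, half-open, unbounded). *)
Definition box (R : realType) (k : nat) (J : 'I_k -> interval R) :
    set 'rV[R]_k :=
  [set t | forall i, t ord0 i \in J i].

Lemma cons_rV_box (R : realType) (k : nat) (J : 'I_k.+1 -> interval R) :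
  @cons_rV R k @^-1` box J = [set` J ord0] `*` box (fun i => J (lift ord0 i)).
Proof.
apply/seteqP; split => [p Jp|p [Jp0 Jp] i].
- split => [|i]; first by have := Jp ord0; rewrite cons_rV0.
  by have := Jp (lift ord0 i); rewrite cons_rVS.
- by case: (unliftP ord0 i) => [j ->|->]; rewrite ?cons_rV0 ?cons_rVS//; exact: Jp.
Qed.

Lemma measurable_box (R : realType) (k : nat) (J : 'I_k -> interval R) :
  measurable (box J : set (borel_rV R k)).
Proof.
elim: k J => [|k ih] J.
  rewrite (_ : box J = setT); first exact: measurableT.
  by apply/seteqP; split => // t _ [].
rewrite (_ : box J = @uncons_rV R k @^-1`
    ([set` J ord0] `*` box (fun i => J (lift ord0 i)))).
  rewrite -[X in measurable X]setTI; apply: measurable_uncons_rV => //.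
  by apply: measurableX => //; exact: measurable_itv.
apply/seteqP; split => [t Jt|t [Jt0 Jt] i].
- by split => [|i] /=; [exact: Jt|rewrite mxE; exact: Jt].
- case: (unliftP ord0 i) => [j ->|->]; last exact: Jt0.
  by have := Jt j; rewrite /= mxE.
Qed.

Lemma lebesgue_rV_box (R : realType) (k : nat) (J : 'I_k -> interval R) :
  lebesgue_rV R k (box J) = (\prod_(i < k) lebesgue_measure [set` J i])%E.
Proof.
elim: k J => [|k ih] J.
  by rewrite big_ord0 /= diracE mem_set// => -[].
rewrite big_ord_recl -ih /= /lebesgue_step /pushforward cons_rV_box.
by rewrite product_measure1E//; exact: measurable_box.
Qed.

Definition unit_cube (R : realType) (k : nat) : set 'rV[R]_k :=
  box (fun=> `[0, 1]).

Arguments unit_cube {R k}.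

Section holder.
Variables (R : realType) (k n : nat).

(* The library's norm on 'rV[R]_m is the sup norm. *)
Definition enorm (m : nat) (x : 'rV[R]_m) : R :=
  Num.sqrt (\sum_(i < m) x ord0 i ^+ 2).

(* Functions on [0,1]^k are represented by total functions of which only the
   values on the cube matter. *)
Implicit Types X : 'rV[R]_k -> 'rV[R]_n.

Definition holder_norm (gamma : R) X : \bar R :=
  ereal_sup [set (enorm (X st.2 - X st.1) / enorm (st.2 - st.1) `^ gamma)%:E |
    st in [set st : 'rV[R]_k * 'rV[R]_k |
      [/\ unit_cube st.1, unit_cube st.2 & st.1 <> st.2]]].

Definition holder0 (gamma : R) : set ('rV[R]_k -> 'rV[R]_n) :=
  [set X | X 0 = 0 /\ (holder_norm gamma X < +oo)%E].

Definition holder0_ball (gamma rho : R) : set ('rV[R]_k -> 'rV[R]_n) :=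
  [set X | holder0 gamma X /\ (holder_norm gamma X <= rho%:E)%E].

End holder.

Section riesz.
Variables (R : realType) (k n : nat).

(* A measure when X is Borel on the cube, see the instance below. *)
Definition occupation_measure (X : 'rV[R]_k -> 'rV[R]_n) :
    set (borel_rV R n) -> \bar R :=
  fun B => lebesgue_rV R k (unit_cube `&` X @^-1` B).

(* The case split is needed because 0 `^ r = 0 in the library when r < 0. *)
Definition riesz_kernel (alpha : R) (x y : 'rV[R]_n) : \bar R :=
  if x == y then +oo%E else (enorm (x - y) `^ (alpha - n%:R))%:E.

Definition riesz_energy (alpha : R) (mu : set (borel_rV R n) -> \bar R) :
    \bar R :=
  (\int[mu]_x \int[mu]_y riesz_kernel alpha x y)%E.

End riesz.

Section occupation_is_measure.
Variables (R : realType) (k n : nat) (X : 'rV[R]_k -> 'rV[R]_n).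
Hypothesis mX : measurable_fun (unit_cube : set (borel_rV R k))
  (X : borel_rV R k -> borel_rV R n).

Lemma occupation_measure0 : occupation_measure X set0 = 0%E.
Proof. by rewrite /occupation_measure preimage_set0 setI0 measure0. Qed.

Lemma occupation_measure_ge0 B : (0 <= occupation_measure X B)%E.
Proof. exact: measure_ge0. Qed.

Lemma occupation_measure_sigma_additive :
  semi_sigma_additive (occupation_measure X).
Proof.
have mc (B : set (borel_rV R n)) : measurable B ->
    measurable (unit_cube `&` X @^-1` B : set (borel_rV R k)).
  by move=> mB; apply: mX => //; exact: measurable_box.
move=> F mF tF mUF; rewrite /occupation_measure preimage_bigcup setI_bigcupr.
apply: measure_semi_sigma_additive.
- by move=> i; exact: mc.
- apply/trivIsetP => /= i j _ _ ij; rewrite setIACA setIid -preimage_setI.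
  by move/trivIsetP : tF => ->//; rewrite preimage_set0 setI0.
- by rewrite -setI_bigcupr -preimage_bigcup; exact: mc.
Qed.

HB.instance Definition _ := isMeasure.Build _ _ _ (occupation_measure X)
  occupation_measure0 occupation_measure_ge0 occupation_measure_sigma_additive.

End occupation_is_measure.

Section hausdorff.
Variables (R : realType) (n : nat).
Implicit Types A E : set 'rV[R]_n.

(* -oo on the empty set *)
Definition ediam E : \bar R :=
  ereal_sup [set (enorm (x.1 - x.2))%:E | x in E `*` E].

(* diam(E)^s, with the conventions 0^0 = 1 for nonempty E and 0 for E empty. *)
Definition diam_pow (s : R) E : \bar R :=
  if E == set0 then 0%E else (ediam E `^ s)%E.

(* No normalising constant in front of the sum. *)
Definition hausdorff_pre (s delta : R) A : \bar R :=
  ereal_inf [set (\sum_(0 <= i <oo) diam_pow s (E i))%E |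
    E in [set E : (set 'rV[R]_n)^nat |
      A `<=` \bigcup_i E i /\ forall i, (ediam (E i) <= delta%:E)%E]].

(* The supremum over delta > 0 is the limit as delta tends to 0. *)
Definition hausdorff_measure (s : R) A : \bar R :=
  ereal_sup [set hausdorff_pre s delta A | delta in [set delta | 0 < delta]].

Definition hausdorff_dim A : \bar R :=
  ereal_inf [set s%:E | s in [set s | 0 <= s /\ hausdorff_measure s A = 0%E]].

End hausdorff.

Definition minimizes (R : realType) (T : Type) (I : T -> \bar R) (S : set T)
    (x : T) : Prop :=
  S x /\ forall y, S y -> (I x <= I y)%E.

(* Main.v *)
Require Import Defs.
From mathcomp Require Import all_boot all_order all_algebra.
From mathcomp Require Import all_classical all_reals all_analysis.
From mathcomp Require Import measurable_realfun ring lra.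

(* Write s = n - alpha and let K_d(x) = (|x| + d)^(-s), d > 0, be the
   regularised kernels, which increase to the Riesz kernel as d decreases to 0;
   E_d is the corresponding energy.

   Minimizers. If |X - Y| <= eta on the cube then E_(d + 2 eta)(X) <= E_d(Y), so
   by compactness of the Hoelder ball (Tychonoff and equicontinuity) and
   monotone convergence, points of the ball with E_d arbitrarily close to the
   infimum, for arbitrarily small d, cluster at a minimizer.

   Finite energy. Average over the coefficients of a Weierstrass-type sum
   X_i(t) = sum_j lam^j a_ij trig(2^j t), where lam = 2^(-g') and
   gamma < g' < k/s. Since K_d(x) <= prod_i (|x_i| + d)^(-s/n) and s/n < 1, the
   single frequency 2^j ~ 1/|t - u| already bounds the mean of K_d(X(t) - X(u))
   by C |t - u|^(-g' s), which is integrable. For each d finitely many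
   coefficients on a finite grid suffice, so a good choice exists by pigeonhole.

   Lower bound. If the energy is finite, its part from |X(t) - X(u)| <= r tends
   to 0 with r; by Markov's inequality most points t have small local potential,
   so a set of diameter D <= r meeting the image of such points has occupation
   measure at most eps D^s, and coverings of X(R) have large s-sums.

   Upper bound. Cover by the images of the cells of a grid. *)

Set Implicit Arguments.
Unset Strict Implicit.
Unset Printing Implicit Defensive.

Import Order.TTheory GRing.Theory Num.Theory.
Import numFieldNormedType.Exports.

Local Open Scope classical_set_scope.
Local Open Scope ring_scope.

(** * The Euclidean norm *)

Section enorm.
Variables (R : realType) (n : nat).
Implicit Types x y : 'rV[R]_n.

Lemma enorm_ge0 x : 0 <= enorm x.
Proof. exact: sqrtr_ge0. Qed.

Lemma enorm_sqr x : enorm x ^+ 2 = \sum_i x ord0 i ^+ 2.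
Proof. by rewrite sqr_sqrtr// sumr_ge0// => i _; rewrite sqr_ge0. Qed.

Lemma coordB x y i : (x - y) ord0 i = x ord0 i - y ord0 i.
Proof. by rewrite !mxE. Qed.

Lemma coord_le_enorm x i : `|x ord0 i| <= enorm x.
Proof.
rewrite -sqrtr_sqr ler_sqrt ?sumr_ge0// => [|j _]; last exact: sqr_ge0.
by rewrite (bigD1 i)//= lerDl sumr_ge0// => j _; exact: sqr_ge0.
Qed.

Lemma enorm_le_sum x : enorm x <= \sum_i `|x ord0 i|.
Proof.
have s0 : 0 <= \sum_i `|x ord0 i| by rewrite sumr_ge0.
rewrite -(ger0_norm s0) -sqrtr_sqr ler_sqrt ?sqr_ge0// expr2 mulr_suml.
apply: ler_sum => i _; rewrite -real_normK ?num_real// expr2.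
by rewrite ler_wpM2l// (bigD1 i)//= lerDl sumr_ge0.
Qed.

Lemma enorm_eq0 x : (enorm x == 0) = (x == 0).
Proof.
apply/eqP/eqP => [x0|->].
  apply/rowP => i; rewrite mxE; apply/eqP; rewrite -normr_eq0 eq_le normr_ge0.
  by rewrite -x0 coord_le_enorm.
by rewrite /enorm big1 ?sqrtr0// => i _; rewrite mxE expr0n.
Qed.

Lemma enorm0 : enorm (0 : 'rV[R]_n) = 0.
Proof. by apply/eqP; rewrite enorm_eq0. Qed.

Lemma enorm_gt0 x : (0 < enorm x) = (x != 0).
Proof. by rewrite lt_neqAle enorm_ge0 andbT eq_sym enorm_eq0. Qed.

Lemma enormN x : enorm (- x) = enorm x.
Proof.
by rewrite /enorm; congr Num.sqrt; apply: eq_bigr => i _; rewrite mxE sqrrN.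
Qed.

Lemma enormBC x y : enorm (x - y) = enorm (y - x).
Proof. by rewrite -enormN opprB. Qed.

(** Sum over [i] of a b <= (s a^2 + s^-1 b^2) / 2. With s = |y| / |x| both halves of the right-hand
    sum become |x| |y| / 2. *)
Lemma cauchy_schwarz x y :
  \sum_i x ord0 i * y ord0 i <= enorm x * enorm y.
Proof.
have [x0|x0] := eqVneq x 0.
  rewrite x0 enorm0 mul0r big1// => i _; by rewrite mxE mul0r.
have [y0|y0] := eqVneq y 0.
  rewrite y0 enorm0 mulr0 big1// => i _; by rewrite mxE mulr0.
have ex : 0 < enorm x by rewrite enorm_gt0.
have ey : 0 < enorm y by rewrite enorm_gt0.
pose s := enorm y / enorm x.
have s0 : 0 < s by rewrite divr_gt0.
apply: (@le_trans _ _
  (\sum_i (s * x ord0 i ^+ 2 + s^-1 * y ord0 i ^+ 2) / 2)).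
  apply: ler_sum => i _; set a := x _ _; set b := y _ _.
  rewrite ler_pdivlMr//.
  have -> : s * a ^+ 2 + s^-1 * b ^+ 2 = s * (a - s^-1 * b) ^+ 2 + a * b * 2.
    by field; rewrite gt_eqF.
  by rewrite lerDr mulr_ge0 ?sqr_ge0// ltW.
rewrite -mulr_suml big_split/= -!mulr_sumr -!enorm_sqr /s.
by rewrite (_ : _ / 2 = enorm x * enorm y)//; field; rewrite !gt_eqF.
Qed.

Lemma enormD x y : enorm (x + y) <= enorm x + enorm y.
Proof.
rewrite -(@ler_pXn2r _ 2)// ?nnegrE ?addr_ge0 ?enorm_ge0//.
rewrite sqrrD !enorm_sqr.
have -> : \sum_i (x + y) ord0 i ^+ 2 = \sum_i x ord0 i ^+ 2 +
    (\sum_i x ord0 i * y ord0 i) *+ 2 + \sum_i y ord0 i ^+ 2.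
  rewrite -sumrMnl -!big_split/=; apply: eq_bigr => i _.
  by rewrite !mxE sqrrD.
by rewrite lerD2r lerD2l lerMn2r cauchy_schwarz.
Qed.

Lemma enormB_trans z x y : enorm (x - y) <= enorm (x - z) + enorm (z - y).
Proof. by have := enormD (x - z) (z - y); rewrite addrA subrK. Qed.

End enorm.

(** * Riesz kernels and their regularisations *)

Lemma ler_powRN (R : realType) (s a b : R) :
  0 <= s -> 0 < a -> a <= b -> b `^ (- s) <= a `^ (- s).
Proof.
move=> s0 a0 ab; have b0 : 0 < b by exact: lt_le_trans ab.
rewrite !powRN lef_pV2 ?posrE ?powR_gt0//.
by rewrite ge0_ler_powR// nnegrE ltW.
Qed.

Lemma powRVK (R : realType) (s a : R) : s != 0 -> 0 <= a ->
  (a `^ s^-1) `^ s = a.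
Proof. by move=> s0 a0; rewrite -powRrM mulVf// powRr1. Qed.

Lemma powR_exprn (R : realType) (a r : R) j : 0 <= a ->
  (a ^+ j) `^ r = (a `^ r) ^+ j.
Proof.
move=> a0; rewrite -[a ^+ j](powR_mulrn j a0) powRAC.
by rewrite (powR_mulrn j (powR_ge0 a r)).
Qed.

Lemma continuous_powR (R : realType) (p x : R) : 0 < x ->
  {for x, continuous (fun a : R => a `^ p)}.
Proof.
move=> x0; apply: differentiable_continuous; apply/derivable1_diffP.
by apply: derivable_powR; rewrite in_itv/= x0.
Qed.

Section kernel.
Variables (R : realType) (n : nat).
Implicit Types x y : 'rV[R]_n.

Definition reg_kernel (s d : R) x : R := (enorm x + d) `^ (- s).

Lemma reg_kernel_ge0 s d x : 0 <= reg_kernel s d x.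
Proof. exact: powR_ge0. Qed.

Lemma reg_kernel_le s d e x y : 0 <= s -> 0 < d ->
  enorm x + d <= enorm y + e -> reg_kernel s e y <= reg_kernel s d x.
Proof.
by move=> s0 d0 xy; apply: ler_powRN => //; rewrite ltr_wpDl// enorm_ge0.
Qed.

Lemma riesz_kernel_ge0 alpha x y : (0 <= riesz_kernel alpha x y)%E.
Proof.
by rewrite /riesz_kernel; case: ifPn => // _; rewrite lee_fin powR_ge0.
Qed.

Lemma reg_kernel_le_riesz alpha d x y : alpha <= n%:R -> 0 < d ->
  ((reg_kernel (n%:R - alpha) d (x - y))%:E <= riesz_kernel alpha x y)%E.
Proof.
move=> an d0; rewrite /riesz_kernel; case: ifPn => [_|xy]; first by rewrite leey.
rewrite lee_fin -(opprB n%:R); apply: ler_powRN; first by rewrite subr_ge0.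
- by rewrite enorm_gt0 subr_eq0.
- by rewrite lerDl ltW.
Qed.

Lemma le_riesz_kernel alpha (r : R) x y : alpha <= n%:R -> 0 < r ->
  enorm (x - y) <= r -> ((r `^ (- (n%:R - alpha)))%:E <= riesz_kernel alpha x y)%E.
Proof.
move=> an r0 xyr; rewrite /riesz_kernel; case: ifPn => [_|xy].
  by rewrite leey.
rewrite lee_fin -(opprB n%:R); apply: ler_powRN => //; first by rewrite subr_ge0.
by rewrite enorm_gt0 subr_eq0.
Qed.

Lemma cvg_reg_kernel alpha x y : alpha < n%:R ->
  (reg_kernel (n%:R - alpha) m.+1%:R^-1 (x - y))%:E @[m --> \oo]
    --> riesz_kernel alpha x y.
Proof.
move=> an; have s0 : 0 < n%:R - alpha by rewrite subr_gt0.
rewrite /riesz_kernel /reg_kernel -(opprB n%:R).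
move: (n%:R - alpha) s0 => s s0; case: ifPn => [/eqP ->|xy].
  (* On the diagonal the regularised kernel is (m+1)^s, which exceeds [A] once m >= A^(1/s). *)
  rewrite subrr enorm0; apply/cvgeryP/cvgryPgt => A.
  near=> m; rewrite add0r -powR_inv1// -powRrM mulN1r opprK.
  have [A0|A0] := leP A 0; first by rewrite (le_lt_trans A0)// powR_gt0.
  rewrite -[A](powRVK (lt0r_neq0 s0) (ltW A0)).
  rewrite gt0_ltr_powR ?nnegrE ?powR_ge0//.
  near: m; apply: filterS (nbhs_infty_gtr (A `^ s^-1)) => m /lt_le_trans; apply.
  by rewrite ler_nat.
apply/fine_cvgP; split; first by apply: nearW.
have e0 : 0 < enorm (x - y) by rewrite enorm_gt0 subr_eq0.
have h : (fun m : nat => enorm (x - y) + m.+1%:R^-1) @ \oo --> enorm (x - y).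
  rewrite -[X in _ --> X]addr0; apply: cvgD; first exact: cvg_cst.
  exact: cvg_harmonic.
exact: (cvg_comp _ _ h (continuous_powR e0)).
Unshelve. all: by end_near. Qed.

End kernel.

(** * Joint measurability of the kernels along a measurable map *)

Section measurability.
Variables (R : realType) (n : nat).

Lemma measurable_coord (i : 'I_n) :
  measurable_fun setT (fun v : borel_rV R n => (v : 'rV[R]_n) ord0 i).
Proof.
apply: (measurability _ (RGenOpens.measurableE R)).
move=> _ [_ [a [b ->]] <-]; rewrite setTI; apply: sub_sigma_algebra.
apply: (@open_comp 'rV[R]_n R (fun v => v ord0 i)) => [v _|].
  exact: coord_continuous.
exact: interval_open.
Qed.

Lemma measurable_enorm d (T : measurableType d) (f : T -> 'rV[R]_n) :
  (forall i, measurable_fun setT (fun t => f t ord0 i)) ->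
  measurable_fun setT (fun t => enorm (f t)).
Proof.
move=> mf; rewrite (_ : (fun t => _) =
    (fun t => (\sum_i f t ord0 i ^+ 2) `^ 2^-1)); last first.
  apply/funext => t; rewrite powR12_sqrt// sumr_ge0// => i _.
  by rewrite sqr_ge0.
apply: (measurableT_comp (measurable_powR _)).
by apply: measurable_sum => i; exact: measurable_funX.
Qed.

Variables (d : measure_display) (T : measurableType d).
Variable Y : T -> borel_rV R n.
Hypothesis mY : measurable_fun setT Y.
Let mYi i : measurable_fun setT (fun t => (Y t : 'rV[R]_n) ord0 i).
Proof. exact: (measurableT_comp (measurable_coord i)). Qed.

Lemma measurable_enormB :
  measurable_fun setT (fun z : T * T => enorm (Y z.1 - Y z.2 : 'rV[R]_n)).
Proof.
apply: measurable_enorm => i.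
rewrite (_ : (fun t => _) = ((fun t => (Y t : 'rV[R]_n) ord0 i) \o fst) \-
  ((fun t => (Y t : 'rV[R]_n) ord0 i) \o snd)); last first.
  by apply/funext => t; rewrite !mxE.
by apply: measurable_funB; exact: measurableT_comp.
Qed.

Lemma measurable_reg_kernel s e : measurable_fun setT
  (fun z : T * T => (reg_kernel s e (Y z.1 - Y z.2 : 'rV[R]_n))%:E).
Proof.
apply/measurable_EFinP; apply: (measurableT_comp (measurable_powR _)).
by apply: measurable_funD => //; exact: measurable_enormB.
Qed.

Lemma measurable_riesz_kernel alpha : alpha < n%:R -> measurable_fun setT
  (fun z : T * T => riesz_kernel alpha (Y z.1 : 'rV[R]_n) (Y z.2)).
Proof.
move=> an; apply: (emeasurable_fun_cvg (fun m (z : T * T) =>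
  (reg_kernel (n%:R - alpha) m.+1%:R^-1 (Y z.1 - Y z.2 : 'rV[R]_n))%:E)).
  by move=> m; exact: measurable_reg_kernel.
by move=> z _; exact: cvg_reg_kernel.
Qed.

End measurability.

(** * Hausdorff measures and dimension *)

Lemma le_ediam (R : realType) (n : nat) (E : set 'rV[R]_n) x y :
  E x -> E y -> ((enorm (x - y))%:E <= ediam E)%E.
Proof. by move=> Ex Ey; apply: ereal_sup_ubound; exists (x, y). Qed.

Lemma diam_pow_ge0 (R : realType) (n : nat) (s : R) (E : set 'rV[R]_n) :
  (0 <= diam_pow s E)%E.
Proof. by rewrite /diam_pow; case: ifP => // _; exact: poweR_ge0. Qed.

(** Chooses the mesh 1/N of a grid so fine that a Hoelder modulus of continuity is at most [e] at
    distances up to a/N. *)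
Lemma small_modulus (R : realType) (C th a e : R) :
  0 <= C -> 0 < th -> 0 <= a -> 0 < e ->
  exists2 N : nat, (0 < N)%N & C * (a / N%:R) `^ th <= e.
Proof.
move=> C0 th0 a0 e0.
(* Dividing by [C + 1] instead of [C] covers the case C = 0. *)
have C1 : 0 < C + 1 by rewrite ltr_wpDl.
have ec : 0 < e / (C + 1) by rewrite divr_gt0.
pose w := (e / (C + 1)) `^ th^-1.
have w0 : 0 < w by rewrite powR_gt0.
exists (Num.truncn (a / w)).+1 => //; set N := _.+1.
have N0 : 0 < N%:R :> R by rewrite ltr0n.
have aN : a / N%:R <= w.
  by rewrite ler_pdivrMr// [w * _]mulrC -ler_pdivrMr// ltW// truncnS_gt.
apply: (@le_trans _ _ (C * (e / (C + 1)))).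
  rewrite ler_wpM2l// -[leRHS](powRVK (lt0r_neq0 th0) (ltW ec)).
  by rewrite ge0_ler_powR ?nnegrE ?powR_ge0 ?(ltW th0)// divr_ge0.
by rewrite mulrCA ler_piMr ?(ltW e0)// ler_pdivrMr// mul1r lerDl.
Qed.

Lemma unit_cube_grid (R : realType) (d N : nat) (t : 'rV[R]_d) :
  (0 < N)%N -> unit_cube t -> exists g : {ffun 'I_d -> 'I_N.+1},
    forall i, `|t ord0 i - (g i)%:R / N%:R| <= N%:R^-1.
Proof.
move=> N_gt0 ct; have N0 : 0 < N%:R :> R by rewrite ltr0n.
have tN i : 0 <= t ord0 i * N%:R <= N%:R.
  have := ct i; rewrite in_itv/= => /andP[t0 t1].
  by rewrite mulr_ge0//= ler_piMl.
(* Rounding down gives the index; it equals [N] when the coordinate is 1, hence the [N.+1]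
   indices. *)
exists [ffun i => inord (Num.truncn (t ord0 i * N%:R))] => i; rewrite ffunE.
have /andP[tN0 tN1] := tN i.
rewrite inordK; last first.
  by rewrite ltnS truncn_le_nat (le_lt_trans tN1)// ltr_nat.
have := truncn_itv tN0; move: (Num.truncn _) => m /andP[a1 a2].
rewrite -[t ord0 i](mulfK (lt0r_neq0 N0)) -mulrBl normrM normfV.
rewrite (gtr0_norm N0) -[leRHS]mul1r ler_pM2r ?invr_gt0// ler_norml.
by move: a2; rewrite -natr1 => a2; apply/andP; split; lra.
Qed.

Section hausdorff_facts.
Variables (R : realType) (n : nat).
Implicit Types (A B E : set 'rV[R]_n) (s t e : R).

Lemma hausdorff_pre_ge0 s e A : (0 <= hausdorff_pre s e A)%E.
Proof.
apply: le_ereal_inf_tmp => _ [E _ <-]; apply: nneseries_ge0 => i _ _.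
exact: diam_pow_ge0.
Qed.

Lemma le_hausdorff_pre s e e' A B : A `<=` B -> e <= e' ->
  (hausdorff_pre s e' A <= hausdorff_pre s e B)%E.
Proof.
move=> AB ee'; apply: ereal_inf_le_tmp => _ [E [cE dE] <-]; exists E => //.
split; first exact: subset_trans cE.
by move=> i; rewrite (le_trans (dE i))// lee_fin.
Qed.

Lemma le_hausdorff_measure s A B : A `<=` B ->
  (hausdorff_measure s A <= hausdorff_measure s B)%E.
Proof.
move=> AB; apply: ge_ereal_sup => _ [e e0 <-].
apply: (@le_trans _ _ (hausdorff_pre s e B)); first exact: le_hausdorff_pre.
by apply: ereal_sup_ubound; exists e.
Qed.

Lemma hausdorff_measure_ge0 s A : (0 <= hausdorff_measure s A)%E.
Proof.
apply: (@le_trans _ _ (hausdorff_pre s 1 A)); first exact: hausdorff_pre_ge0.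
by apply: ereal_sup_ubound; exists 1 => //=.
Qed.

Lemma ediam_fin_num (e : R) E : E !=set0 -> (ediam E <= e%:E)%E ->
  exists2 D : R, 0 <= D <= e & ediam E = D%:E.
Proof.
move=> [x Ex] Ee; have := le_ediam Ex Ex; rewrite subrr enorm0.
case: (ediam E) Ee => [D| |]//; rewrite !lee_fin => De D0.
by exists D => //; apply/andP.
Qed.

Lemma diam_pow_ler s (e : R) E : 0 <= s -> 0 <= e -> (ediam E <= e%:E)%E ->
  (diam_pow s E <= (e `^ s)%:E)%E.
Proof.
move=> s0 e0 Ee; rewrite /diam_pow; case: ifPn => [_|/set0P E0].
  by rewrite lee_fin powR_ge0.
have [D /andP[D0 De] ->] := ediam_fin_num E0 Ee.
by rewrite poweR_EFin lee_fin ge0_ler_powR.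
Qed.

Lemma diam_pow_le s t e E : 0 <= s -> s < t -> (ediam E <= e%:E)%E ->
  (diam_pow t E <= (e `^ (t - s))%:E * diam_pow s E)%E.
Proof.
move=> s0 st Ee; rewrite /diam_pow; case: ifPn => [_|/set0P E0].
  by rewrite mule0.
have [D /andP[D0 De] ->] := ediam_fin_num E0 Ee.
have ts : 0 < t - s by rewrite subr_gt0.
(* The factorisation D^t = D^(t-s) D^s may fail at D = 0, because 0^0 = 1; there D^t = 0 since t >
   0. *)
rewrite !poweR_EFin -EFinM lee_fin; have [->|Dneq] := eqVneq D 0.
  rewrite [X in X <= _]powR0 ?gt_eqF ?(le_lt_trans s0)//.
  by rewrite mulr_ge0// powR_ge0.
rewrite -[X in D `^ X <= _](subrK s) [X in X <= _]powRD; last by rewrite Dneq implybT.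
rewrite ler_wpM2r ?powR_ge0// ge0_ler_powR ?nnegrE ?(ltW ts)//.
exact: le_trans De.
Qed.

(** For sets of diameter at most e', diam^t <= e'^(t-s) diam^s, and the factor e'^(t-s) is as small
    as desired. *)
Lemma hausdorff_measure_lty s t A : 0 <= s -> s < t ->
  (hausdorff_measure s A < +oo)%E -> hausdorff_measure t A = 0%E.
Proof.
move=> s0 st Hoo; apply/eqP; rewrite eq_le hausdorff_measure_ge0 andbT.
have ts : 0 < t - s by rewrite subr_gt0.
have HE : hausdorff_measure s A = (fine (hausdorff_measure s A))%:E.
  by rewrite fineK// ge0_fin_numE// hausdorff_measure_ge0.
set h := fine _ in HE.
have h0 : 0 <= h by rewrite -lee_fin -HE hausdorff_measure_ge0.
apply: ge_ereal_sup => _ [e /= e0 <-]; apply/lee_addgt0Pr => eps eps0; rewrite add0e.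
(* A cover with s-sum at most h + 1 then has t-sum at most e'^(t-s) (h + 1) <= [eps]. *)
pose e' := Num.min e ((eps / (h + 1)) `^ (t - s)^-1).
have w0 : 0 < eps / (h + 1) by rewrite divr_gt0// ltr_wpDl.
have e'0 : 0 < e' by rewrite lt_min e0 powR_gt0.
apply: (@le_trans _ _ (hausdorff_pre t e' A)).
  by apply: le_hausdorff_pre => //; rewrite ge_min lexx.
apply: (@le_trans _ _ ((eps / (h + 1))%:E * (h + 1)%:E)%E); last first.
  by rewrite -EFinM lee_fin divfK// gt_eqF// ltr_wpDl.
have : (hausdorff_pre s e' A < (h + 1)%:E)%E.
  apply: (@le_lt_trans _ _ (hausdorff_measure s A)).
    by apply: ereal_sup_ubound; exists e'.
  by rewrite HE lte_fin ltrDl.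
move=> /ereal_inf_lt[_ [E [cE dE] <-] /ltW Eh].
apply: (@le_trans _ _ (\sum_(0 <= i <oo) diam_pow t (E i))%E).
  by apply: ereal_inf_lbound; exists E.
apply: (@le_trans _ _
  ((eps / (h + 1))%:E * \sum_(0 <= i <oo) diam_pow s (E i))%E); last first.
  by rewrite lee_pmul2l// lte_fin.
rewrite -nneseriesZl; last by move=> i _; exact: diam_pow_ge0.
apply: lee_nneseries => [i _ _|i _]; first exact: diam_pow_ge0.
apply: (le_trans (diam_pow_le s0 st (dE i))).
rewrite lee_wpmul2r ?diam_pow_ge0// lee_fin.
rewrite -[leRHS](powRVK (lt0r_neq0 ts) (ltW w0)).
by rewrite ge0_ler_powR ?nnegrE ?powR_ge0 ?(ltW e'0) ?(ltW ts)// ge_min lexx orbT.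
Qed.

Lemma hausdorff_dim_le s A : 0 <= s -> (hausdorff_measure s A < +oo)%E ->
  (hausdorff_dim A <= s%:E)%E.
Proof.
move=> s0 Hoo; apply/lee_addgt0Pr => eps eps0; rewrite -EFinD.
apply: ereal_inf_lbound; exists (s + eps) => //; split; first by rewrite addr_ge0// ltW.
by apply: hausdorff_measure_lty Hoo => //; rewrite ltrDl.
Qed.

Lemma hausdorff_dim_ge s A : hausdorff_measure s A = +oo%E ->
  (s%:E <= hausdorff_dim A)%E.
Proof.
move=> Hoo; apply: le_ereal_inf_tmp => _ [t [t0 Ht] <-].
rewrite lee_fin leNgt; apply/negP => ts.
by have := @hausdorff_measure_lty t s A t0 ts; rewrite Ht Hoo => /(_ (ltry _)).
Qed.

Lemma hausdorff_pre_finite_cover (I : finType) (E : I -> set 'rV[R]_n) s v e A :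
  (A `<=` \bigcup_i E i) -> 0 <= e ->
  (forall i, (ediam (E i) <= e%:E)%E) ->
  (forall i, (diam_pow s (E i) <= v%:E)%E) ->
  (hausdorff_pre s e A <= (#|I|%:R * v)%:E)%E.
Proof.
move=> cE e0 dE vE.
(* The family is continued by empty sets, for which [diam_pow] is 0 whatever the exponent. *)
pose F (m : nat) := if insub m is Some j then E (enum_val (j : 'I_#|I|)) else set0.
have F0 m : (#|I| <= m)%N -> F m = set0 by move=> Im; rewrite /F insubF// ltnNge Im.
have FE (j : 'I_#|I|) : F j = E (enum_val j) by rewrite /F valK.
apply: (@le_trans _ _ (\sum_(0 <= m <oo) diam_pow s (F m))%E).
  apply: ereal_inf_lbound; exists F => //; split.
    move=> x /cE[i _ Eix]; exists (enum_rank i) => //.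
    by rewrite FE enum_rankK.
  move=> m; have [Im|mI] := leqP #|I| m; last by rewrite (FE (Ordinal mI)).
  rewrite F0//; apply: ge_ereal_sup => _ [x [/= []]].
rewrite (nneseries_split 0 #|I|); last by move=> *; exact: diam_pow_ge0.
rewrite add0n [X in (_ + X)%E]eseries0 ?adde0; last first.
  by move=> m Im _; rewrite F0// /diam_pow eqxx.
rewrite big_mkord.
apply: (@le_trans _ _ (\sum_(j < #|I|) v%:E)%E).
  by apply: lee_sum => j _; rewrite FE.
by rewrite sumEFin sumr_const card_ord mulr_natl.
Qed.

(** The (N+1)^d grid cells have images of diameter at most r = C (2d/N)^th. Since r^(d/th) =
    C^(d/th) (2d/N)^d and N + 1 <= 2N, the sum is at most C^(d/th) (4d)^d, uniformly in N. *)
Lemma hausdorff_measure_holder (d : nat) (f : 'rV[R]_d -> 'rV[R]_n) (C th : R) :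
  (0 < d)%N -> 0 <= C -> 0 < th ->
  (forall t u : 'rV[R]_d, unit_cube t -> unit_cube u ->
    enorm (f t - f u) <= C * enorm (t - u) `^ th) ->
  (hausdorff_measure (d%:R / th) (f @` unit_cube) < +oo)%E.
Proof.
move=> d0 C0 th0 hf.
apply: (@le_lt_trans _ _ (C `^ (d%:R / th) * (4 * d%:R) ^+ d)%:E); last exact: ltry.
apply: ge_ereal_sup => _ [e /= e0 <-].
have [N N_gt0 re] := small_modulus C0 th0 (ler0n R (2 * d)) e0.
have N0 : 0 < N%:R :> R by rewrite ltr0n.
rewrite natrM in re.
have dN0 : 0 <= 2 * d%:R / N%:R :> R by rewrite divr_ge0// mulr_ge0.
set r := C * _ in re.
have r0 : 0 <= r by rewrite mulr_ge0// powR_ge0.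
pose Q (g : {ffun 'I_d -> 'I_N.+1}) := f @` [set t : 'rV[R]_d | unit_cube t /\
  forall i, `|t ord0 i - (g i)%:R / N%:R| <= N%:R^-1].
have Qr g : (ediam (Q g) <= r%:E)%E.
  apply: ge_ereal_sup => _ [[_ _] /= [[t [ct tg] <-] [u [cu ug] <-]] <-].
  rewrite lee_fin (le_trans (hf _ _ ct cu))// ler_wpM2l//.
  rewrite ge0_ler_powR ?nnegrE ?enorm_ge0 ?(ltW th0)//.
  apply: (le_trans (enorm_le_sum _)).
  apply: (@le_trans _ _ (\sum_(i < d) 2 / N%:R)).
    apply: ler_sum => i _; rewrite !mxE.
    have -> : t ord0 i - u ord0 i =
      (t ord0 i - (g i)%:R / N%:R) - (u ord0 i - (g i)%:R / N%:R) by ring.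
    apply: (le_trans (ler_normB _ _)).
    by rewrite mulrDl mul1r lerD.
  by rewrite sumr_const card_ord -[leLHS]mulr_natr mulrAC.
apply: (le_trans (hausdorff_pre_finite_cover (E := Q) (e := e)
  (v := r `^ (d%:R / th)) _ _ _ _)) => //.
  - move=> _ [t ct <-]; have [g gt] := unit_cube_grid N_gt0 ct.
    by exists g => //; exists t.
  - exact: ltW.
  - by move=> g; rewrite (le_trans (Qr g))// lee_fin.
  - by move=> g; apply: diam_pow_ler => //; rewrite divr_ge0// ltW.
rewrite lee_fin card_ffun !card_ord /r powRM// ?powR_ge0// -powRrM.
rewrite (_ : th * _ = d%:R); last by field; rewrite lt0r_neq0.
rewrite powR_mulrn// mulrCA ler_wpM2l ?powR_ge0//.
rewrite natrX -exprMn lerXn2r ?nnegrE ?mulr_ge0//.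
rewrite mulrA ler_pdivrMr//.
rewrite (_ : 4 * _ * _ = (2 * N%:R) * (2 * d%:R)); last by ring.
rewrite ler_wpM2r ?mulr_ge0// -natrM ler_nat mul2n -addnn -addn1 leq_add2l.
by [].
Qed.

End hausdorff_facts.

(** * Energies *)

Section energy.
Context {R : realType} {n : nat} d {T : measurableType d}.
Variables (P : {finite_measure set T -> \bar R}) (alpha : R).
Variable Y : T -> borel_rV R n.
Hypotheses (mY : measurable_fun setT Y) (an : alpha < n%:R).

Local Notation s := (n%:R - alpha).

Definition reg_energy (e : R) : \bar R :=
  (\int[P \x P]_z (reg_kernel s e (Y z.1 - Y z.2 : 'rV[R]_n))%:E)%E.

Definition riesz_energy_prod : \bar R :=
  (\int[P \x P]_z riesz_kernel alpha (Y z.1 : 'rV[R]_n) (Y z.2))%E.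

Let s_ge0 : 0 <= s. Proof. by rewrite subr_ge0 ltW. Qed.

(** A change of variables in each of the two integrals, followed by Tonelli. From here on energies
    are integrals over the parameter space. *)
Lemma riesz_energy_pushforward :
  riesz_energy alpha (pushforward P Y) = riesz_energy_prod.
Proof.
have mid : measurable_fun setT (fun z : borel_rV R n * borel_rV R n =>
    riesz_kernel alpha (z.1 : 'rV[R]_n) z.2).
  by apply: (@measurable_riesz_kernel _ _ _ _ id).
have mxu : measurable_fun setT (fun z : borel_rV R n * T =>
    riesz_kernel alpha (z.1 : 'rV[R]_n) (Y z.2)).
  apply: (measurableT_comp mid (g := fun z => (z.1, Y z.2))).
  apply/measurable_fun_pairP; split; first exact: measurable_fst.
  exact: (measurableT_comp mY measurable_snd).
rewrite /riesz_energy /riesz_energy_prod.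
transitivity (\int[pushforward P Y]_x \int[P]_u
    riesz_kernel alpha (x : 'rV[R]_n) (Y u))%E.
  apply: (eq_integral (mu := pushforward P Y)) => [|x _]; first exact: mY.
  have mKx : measurable_fun setT (riesz_kernel alpha (x : 'rV[R]_n) :
      borel_rV R n -> \bar R).
    exact: (measurableT_comp mid (pair1_measurable x)).
  have Kx0 : {in setT, forall y : borel_rV R n,
      (0 <= riesz_kernel alpha (x : 'rV[R]_n) y)%E}.
    by move=> y _; exact: riesz_kernel_ge0.
  by rewrite (ge0_integral_pushforward mY P measurableT mKx Kx0).
have mF := measurable_fun_fubini_tonelli_F (m2 := P)
  (fun z : borel_rV R n * T => riesz_kernel alpha (z.1 : 'rV[R]_n) (Y z.2))
  mxu (fun z => riesz_kernel_ge0 _ _ _).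
rewrite (ge0_integral_pushforward mY P measurableT mF); last first.
  by move=> x _; apply: integral_ge0 => u _; exact: riesz_kernel_ge0.
rewrite preimage_setT fubini_tonelli1//; first exact: measurable_riesz_kernel.
by move=> z; exact: riesz_kernel_ge0.
Qed.

Lemma reg_energy_le_riesz e : 0 < e -> (reg_energy e <= riesz_energy_prod)%E.
Proof.
move=> e0; apply: ge0_le_integral => //.
- by move=> z _; rewrite lee_fin reg_kernel_ge0.
- exact: measurable_reg_kernel.
- exact: measurable_riesz_kernel.
- by move=> z _; rewrite reg_kernel_le_riesz// ltW.
Qed.

Lemma cvg_reg_energy :
  reg_energy m.+1%:R^-1 @[m --> \oo] --> riesz_energy_prod.
Proof.
pose f m (z : T * T) := (reg_kernel s m.+1%:R^-1 (Y z.1 - Y z.2 : 'rV[R]_n))%:E.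
have fK z : f m z @[m --> \oo] --> riesz_kernel alpha (Y z.1 : 'rV[R]_n) (Y z.2).
  exact: cvg_reg_kernel.
rewrite /riesz_energy_prod.
under eq_integral do rewrite -(cvg_lim _ (fK _))//.
apply: cvg_monotone_convergence => //.
- by move=> m; exact: measurable_reg_kernel.
- by move=> m z _; rewrite lee_fin reg_kernel_ge0.
- move=> z _ a b ab; rewrite lee_fin reg_kernel_le// lerD2l.
  by rewrite lef_pV2 ?posrE// ler_nat.
Qed.

Lemma riesz_energy_le_reg (c : \bar R) :
  (forall e, 0 < e -> (reg_energy e <= c)%E) -> (riesz_energy_prod <= c)%E.
Proof.
move=> h; rewrite -(cvg_lim _ cvg_reg_energy)//.
apply: lime_le; first by apply/cvg_ex; exists riesz_energy_prod; exact: cvg_reg_energy.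
by apply: nearW => m; apply: h.
Qed.

End energy.

(** * Finite energy and Hausdorff measure *)

Section energy_and_hausdorff.
Context {R : realType} {n : nat} d {T : measurableType d}.
Variables (P : {finite_measure set T -> \bar R}) (alpha : R).
Variable Y : T -> borel_rV R n.
Hypotheses (mY : measurable_fun setT Y) (an : alpha < n%:R).

Local Notation s := (n%:R - alpha).
Let s_gt0 : 0 < s. Proof. by rewrite subr_gt0. Qed.
Let K (z : T * T) := riesz_kernel alpha (Y z.1 : 'rV[R]_n) (Y z.2).
Let S (r : R) := [set z : T * T | enorm (Y z.1 - Y z.2 : 'rV[R]_n) <= r].

Hypothesis fin_energy : (riesz_energy_prod P alpha Y < +oo)%E.

Let measurable_S r : measurable (S r).
Proof.
rewrite -[S r]setTI.
rewrite (_ : S r = (fun z => enorm (Y z.1 - Y z.2 : 'rV[R]_n)) @^-1` `]-oo, r]).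
  by apply: (measurable_enormB mY) => //; exact: measurable_itv.
by apply/seteqP; split => z; rewrite /S /= in_itv.
Qed.

Let K_ge0 z : (0 <= K z)%E. Proof. exact: riesz_kernel_ge0. Qed.

Let measurable_KS r : measurable_fun setT (K \_ (S r)).
Proof.
apply/(measurable_restrictT _ _).1 => //.
by apply: measurable_funTS; exact: measurable_riesz_kernel.
Qed.

Let KS_ge0 r z : (0 <= (K \_ (S r)) z)%E.
Proof. by rewrite patchE; case: ifPn. Qed.

(* Near the diagonal the regularised kernel is at most half the kernel, so the
   energy there is controlled by the defect of the regularised energy. *)
Let near_diagonal (eps : R) : 0 < eps ->
  exists2 r : R, 0 < r & (\int[P \x P]_z (K \_ (S r)) z <= eps%:E)%E.
Proof.
move=> eps0.
(* Chosen so that (1+q)^(-s) = 1/2: if x <= e/q then x + e >= (1+q) x, so (x+e)^(-s) <= x^(-s) /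
   2. *)
pose q := 2 `^ s^-1 - 1 : R.
have q0 : 0 < q.
  have h : 1 `^ s^-1 = 1 :> R by rewrite powR1.
  by rewrite subr_gt0 -[ltLHS]h gt0_ltr_powR ?invr_gt0// ?nnegrE ?ltr1n.
have q1s : (1 + q) `^ (- s) = 2^-1.
  by rewrite /q addrC subrK powRN -powRrM mulVf ?lt0r_neq0// powRr1.
clearbody q; pose I := fine (riesz_energy_prod P alpha Y).
have I0 : (0 <= riesz_energy_prod P alpha Y)%E.
  by apply: integral_ge0 => z _; exact: riesz_kernel_ge0.
have IE : riesz_energy_prod P alpha Y = I%:E by rewrite fineK// ge0_fin_numE.
have [e [e0 Ee]] : exists e, 0 < e /\ ((I - eps / 2)%:E < reg_energy P alpha Y e)%E.
  apply: contrapT => /forallNP h.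
  have : (riesz_energy_prod P alpha Y <= (I - eps / 2)%:E)%E.
    apply: riesz_energy_le_reg => // e e0; rewrite leNgt; apply/negP => he.
    exact: (h e).
  by rewrite IE lee_fin lerBrDr gerDl leNgt divr_gt0.
exists (q^-1 * e); first by rewrite mulr_gt0// invr_gt0.
set r := q^-1 * e.
(* On [S r] the kernel dominates its regularisation plus half of itself. With E_e > I - eps/2 this
   bounds the energy near the diagonal by 2 (I - E_e) < [eps]. *)
have : (reg_energy P alpha Y e + \int[P \x P]_z (2^-1%:E * (K \_ (S r)) z)
    <= I%:E)%E.
  rewrite -IE -ge0_integralD//=; last 4 first.
  - by move=> z _; rewrite lee_fin reg_kernel_ge0.
  - exact: measurable_reg_kernel.
  - by move=> z _; rewrite mule_ge0// lee_fin.
  - by apply: emeasurable_funM => //; exact: measurable_KS.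
  apply: ge0_le_integral => //.
  - by move=> z _; rewrite adde_ge0// ?mule_ge0// lee_fin reg_kernel_ge0.
  - apply: emeasurable_funD; first exact: measurable_reg_kernel.
    by apply: emeasurable_funM => //; exact: measurable_KS.
  - exact: measurable_riesz_kernel.
  move=> z _; rewrite patchE; case: ifPn; last first.
    by move=> _; rewrite mule0 adde0 reg_kernel_le_riesz// ltW.
  rewrite inE /S /K /riesz_kernel /=; case: ifPn => [_|xy xyr]; first by rewrite leey.
  have e1 : 0 < enorm (Y z.1 - Y z.2 : 'rV[R]_n) by rewrite enorm_gt0 subr_eq0.
  rewrite -(opprB n%:R) -EFinM -EFinD lee_fin /reg_kernel.
  set x := enorm _ in e1 xyr *.
  have : (x + e) `^ (- s) <= 2^-1 * x `^ (- s).
    rewrite -q1s -powRM ?addr_ge0 ?(ltW q0) ?(ltW e1)//.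
    apply: ler_powRN; [exact: ltW|by rewrite mulr_gt0// addr_gt0|].
    by rewrite mulrDl mul1r lerD2l -ler_pdivlMl.
  lra.
rewrite (ge0_integralZl _ measurableT (measurable_KS r)) ?lee_fin ?invr_ge0//.
set J := (\int[_]_z _ z)%E => h.
have J0 : (0 <= J)%E by apply: integral_ge0 => z _; exact: KS_ge0.
move: h Ee J0; case: (reg_energy P alpha Y e) => [a| |]; case: J => [j| |]//.
  by rewrite -EFinM -EFinD !lee_fin lte_fin => *; lra.
all: by rewrite gt0_muley ?lte_fin ?invr_gt0//.
Qed.

(** A Frostman-type mass distribution argument. As finite energy makes the near-diagonal part
    arbitrarily small, the constant [lam^-1] in the mass bound can be taken arbitrarily small,
    whence an infinite measure and not merely a positive one. *)
Lemma hausdorff_measure_finite_energy (B : set T) : measurable B ->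
  (0 < P B)%E -> hausdorff_measure s (Y @` B) = +oo%E.
Proof.
move=> mB PB0.
pose b := fine (P B).
have PBE : P B = b%:E by rewrite fineK// fin_num_measure.
have b0 : 0 < b by rewrite -lte_fin -PBE.
apply: eq_infty => M.
(* Half of the mass of [B] survives below, and lam b/2 = |M| + 1 exceeds the target [M]. *)
pose lam := (`|M| + 1) * 2 / b.
have lam0 : 0 < lam by rewrite divr_gt0// mulr_gt0// ltr_wpDl.
have [rho rho0 Krho] : exists2 r : R, 0 < r &
    (\int[P \x P]_z (K \_ (S r)) z <= (lam^-1 * (b / 2))%:E)%E.
  by apply: near_diagonal; rewrite mulr_gt0 ?invr_gt0 ?divr_gt0.
pose p t := (\int[P]_u (K \_ (S rho)) (t, u))%E.
have p0 t : (0 <= p t)%E by apply: integral_ge0 => z _; exact: KS_ge0.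
have mp : measurable_fun setT p.
  exact: (measurable_fun_fubini_tonelli_F (m2 := P) _ (measurable_KS rho)).
pose bad := [set t | (lam^-1%:E <= `|p t|)%E].
have mbad : measurable bad.
  rewrite -[bad]setTI; apply: emeasurable_fun_c_infty => //.
  exact: measurableT_comp.
(* Markov's inequality: the integral of [p] is at most lam^-1 b/2. *)
have Pbad : (P bad <= (b / 2)%:E)%E.
  have := @le_integral_abse _ _ _ P setT measurableT p lam^-1 mp.
  rewrite setTI invr_gt0 => /(_ lam0) h.
  have : (lam^-1%:E * P bad <= (lam^-1 * (b / 2))%:E)%E.
    apply: (le_trans h); apply: le_trans Krho.
    rewrite (fubini_tonelli1 _ (measurable_KS rho) (KS_ge0 rho)).
    apply: ge0_le_integral => //; first exact: measurableT_comp.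
    by move=> t _; rewrite gee0_abs.
  by rewrite EFinM lee_pmul2l// ?lte_fin ?invr_gt0.
pose G := B `\` bad.
have mG : measurable G by exact: measurableD.
have PG : ((b / 2)%:E <= P G)%E.
  have : (P B <= P G + P bad)%E.
    apply: (@le_trans _ _ (P (G `|` bad))); last exact: measureU2.
    rewrite le_measure ?inE//; first exact: measurableU.
    by move=> t Bt; have [?|?] := pselect (bad t); [right|left; split].
  have /fineK <- : P G \is a fin_num by exact: fin_num_measure.
  have /fineK : P bad \is a fin_num by exact: fin_num_measure.
  move: Pbad; rewrite PBE; case: (P bad) => [x| |]//.
  by rewrite -EFinD !lee_fin => *; lra.
apply: (@le_trans _ _ (hausdorff_pre s rho (Y @` B))); last first.
  by apply: ereal_sup_ubound; exists rho.
apply: le_ereal_inf_tmp => _ [E [cE dE] <-].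
(* The sets [E i] need not be measurable, so the part of [G] mapped into [E i] is enclosed in the
   preimage of a closed ball of radius diam([E i]) centred at the image of a point of [G]. *)
have [F FP] : exists F : (set T)^nat, forall i, [/\ measurable (F i),
    forall t, G t -> E i (Y t) -> F i t &
    (P (F i) <= lam^-1%:E * diam_pow s (E i))%E].
  suff : forall i, exists Fi : set T, [/\ measurable Fi,
    forall t, G t -> E i (Y t) -> Fi t &
    (P Fi <= lam^-1%:E * diam_pow s (E i))%E] by move=> /choice[F FP]; exists F.
  move=> i; have [[t [Gt Et]]|nt] := pselect (exists t, G t /\ E i (Y t)); last first.
    exists set0; split => //; first by move=> t Gt Et; apply: nt; exists t.
    by rewrite measure0 mule_ge0 ?diam_pow_ge0// lee_fin invr_ge0 ltW.
  have E0 : E i != set0 by apply/set0P; exists (Y t).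
  pose D := fine (ediam (E i)).
  have D0 : (0 <= ediam (E i))%E.
    by have := le_ediam Et Et; rewrite subrr enorm0.
  have DE : ediam (E i) = D%:E.
    by rewrite fineK// ge0_fin_numE// (le_lt_trans (dE i))// ltry.
  rewrite /diam_pow (negbTE E0) DE poweR_EFin.
  move: D0 (dE i); rewrite DE !lee_fin => D0 Drho.
  exists [set u | enorm (Y t - Y u : 'rV[R]_n) <= D].
  have mF : measurable [set u | enorm (Y t - Y u : 'rV[R]_n) <= D].
    have := measurable_xsection t (measurable_S D).
    by congr measurable; apply/seteqP; split => u; rewrite /xsection/= inE.
  split => //.
    by move=> u Gu Eu /=; rewrite -lee_fin -DE; exact: le_ediam.
  set F := [set u | _] in mF *.
  have pt : (p t < lam^-1%:E)%E.
    by case: Gt => _ /negP; rewrite /bad/= -ltNge gee0_abs.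
  (* On [F] the kernel seen from [t] is at least D'^(-s), while the local potential at [t] is below
     [lam^-1]. A radius D' > 0 is used because [D] may vanish. *)
  have key (D' : R) : 0 < D' -> D <= D' -> D' <= rho ->
      (P F <= (lam^-1 * D' `^ s)%:E)%E.
    move=> D'0 DD' D'rho.
    have : ((D' `^ (- s))%:E * P F <= lam^-1%:E)%E.
      rewrite -(integral_cst P mF).
      apply: le_trans (ltW pt); rewrite integral_mkcond.
      apply: ge0_le_integral => //.
      - by move=> u _; rewrite patchE; case: ifP => // _; rewrite lee_fin powR_ge0.
      - by apply/(measurable_restrictT _ _).1.
      - exact: (measurableT_comp (measurable_KS rho) (pair1_measurable t)).
      move=> u _; rewrite patchE; case: ifPn => // Fu; rewrite patchE.
      move: Fu; rewrite inE /F/= => Fu.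
      rewrite mem_set; last by rewrite /S/=; apply: le_trans Fu _.
      by apply: le_riesz_kernel; [exact: ltW|by []|exact: le_trans Fu _].
    have /fineK <- : P F \is a fin_num by exact: fin_num_measure.
    rewrite -EFinM !lee_fin powRN mulrC ler_pdivrMr ?powR_gt0//.
  have [Dp|] := ltP 0 D; first by rewrite -EFinM; exact: key.
  (* For D = 0 the claim is that [F] is null: a mass q > 0 would satisfy q <= q/2, by [key] at a
     radius with D'^s <= q lam / 2. *)
  move=> Dn; have {Dn D0}D0 : D = 0 by apply/eqP; rewrite eq_le Dn.
  rewrite D0 powR0 ?lt0r_neq0// mule0.
  have PFE : P F = (fine (P F))%:E by rewrite fineK// fin_num_measure.
  rewrite PFE lee_fin leNgt; apply/negP => q0; set q := fine _ in q0 PFE.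
  pose D' := Num.min rho ((q * lam / 2) `^ s^-1).
  have D'0 : 0 < D' by rewrite lt_min rho0 powR_gt0// divr_gt0// mulr_gt0.
  have := key D' D'0; rewrite D0 ltW// ge_min lexx => /(_ erefl erefl).
  rewrite PFE lee_fin leNgt => /negP; apply.
  apply: (@le_lt_trans _ _ (lam^-1 * (q * lam / 2))).
    rewrite ler_pM2l ?invr_gt0//.
    have w0 : 0 <= q * lam / 2 by rewrite divr_ge0// mulr_ge0// ltW.
    rewrite -[leRHS](powRVK (lt0r_neq0 s_gt0) w0).
    by rewrite ge0_ler_powR ?nnegrE ?powR_ge0 ?(ltW D'0) ?(ltW s_gt0)// ge_min lexx orbT.
  rewrite (_ : lam^-1 * _ = q / 2); first by rewrite ltr_pdivrMr// ltr_pMr// ltr1n.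
  by field; rewrite lt0r_neq0.
have : (P G <= \sum_(0 <= i <oo) P (F i))%E.
  apply: measure_sigma_subadditive => //; first by move=> i; have [] := FP i.
  move=> t Gt; have [i _ Et] : (\bigcup_i E i) (Y t).
    by apply: cE; exists t => //; case: Gt.
  by exists i => //; have [_ + _] := FP i; exact.
move=> /(le_trans PG) h.
have {}h : ((b / 2)%:E <= lam^-1%:E * \sum_(0 <= i <oo) diam_pow s (E i))%E.
  apply: (le_trans h); rewrite -nneseriesZl; last first.
    by move=> i _; exact: diam_pow_ge0.
  by apply: lee_nneseries => // i _; have [] := FP i.
apply: (@le_trans _ _ (lam%:E * (b / 2)%:E)%E).
  rewrite -EFinM lee_fin /lam (_ : (`|M| + 1) * 2 / b * (b / 2) = `|M| + 1).
    by rewrite (le_trans (ler_norm _))// lerDl.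
  by field; rewrite lt0r_neq0.
rewrite -(@lee_pmul2l _ lam^-1%:E)//; last by rewrite lte_fin invr_gt0.
by rewrite muleA -!EFinM mulVf ?lt0r_neq0// mul1r.
Qed.

End energy_and_hausdorff.

(** * Compactness of Hoelder balls *)

Section clamp.
Variables (R : realType) (k : nat).
Implicit Types t u : 'rV[R]_k.

(** The retraction of the space onto the unit cube. Composing a path with it gives a total
    continuous map with the same values on the cube. *)
Definition clamp t : 'rV[R]_k := \row_i Num.max 0 (Num.min 1 (t ord0 i)).

Lemma clamp_unit_cube t : unit_cube (clamp t).
Proof.
move=> i; rewrite mxE in_itv/= le_max lexx/= ge_max ler01/=.
by rewrite ge_min lexx.
Qed.

Lemma clamp_id t : unit_cube t -> clamp t = t.
Proof.
move=> ct; apply/rowP => i; rewrite mxE.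
by have := ct i; rewrite in_itv/= => /andP[t0 t1]; rewrite min_r// max_r.
Qed.

Lemma clamp_contraction t u i :
  `|clamp t ord0 i - clamp u ord0 i| <= `|t ord0 i - u ord0 i|.
Proof.
rewrite !mxE; move: (t _ _) (u _ _) => a b.
have := ler_norm (a - b); have := ler_norm (b - a); rewrite [`|b - a|]distrC.
move: `|a - b| => m h1 h2; rewrite ler_norml.
by rewrite /Num.max /Num.min; case: (ltP 1 a) => ?; case: (ltP 1 b) => ?; case: ltP => ?;
  case: ltP => ?; apply/andP; split; lra.
Qed.

Lemma unit_cube0 : unit_cube (0 : 'rV[R]_k).
Proof. by move=> i; rewrite mxE in_itv/= lexx ler01. Qed.

End clamp.
Section holder_ball.
Variables (R : realType) (k n : nat).
Implicit Types (X : 'rV[R]_k -> 'rV[R]_n).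

Lemma holder0_ballP (gamma rho : R) X : 0 < gamma ->
  holder0_ball gamma rho X <-> X 0 = 0 /\
    forall t u, unit_cube t -> unit_cube u ->
      enorm (X t - X u) <= rho * enorm (t - u) `^ gamma.
Proof.
move=> g0; split => [[[X0 _] hX]|[X0 hX]].
  split => // t u ct cu; have [->|tu] := eqVneq t u.
    by rewrite !subrr !enorm0 powR0 ?gt_eqF// mulr0.
  have e0 : 0 < enorm (t - u) `^ gamma by rewrite powR_gt0// enorm_gt0 subr_eq0.
  rewrite -ler_pdivrMr// -lee_fin; apply: le_trans hX.
  by apply: ereal_sup_ubound; exists (u, t) => //; split => //= ut; rewrite ut eqxx in tu.
have hr : (holder_norm gamma X <= rho%:E)%E.
  apply: ge_ereal_sup => _ [[u t] /= [cu ct ut] <-]; rewrite lee_fin.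
  rewrite ler_pdivrMr; first exact: hX.
  by rewrite powR_gt0// enorm_gt0 subr_eq0; apply/eqP => tu; apply: ut.
by split => //; split => //; exact: le_lt_trans (ltry rho).
Qed.

Lemma enorm_le_card (m : nat) (x : 'rV[R]_m) (e : R) :
  (forall i, `|x ord0 i| <= e) -> enorm x <= m%:R * e.
Proof.
move=> h; apply: (le_trans (enorm_le_sum _)).
apply: (@le_trans _ _ (\sum_(i < m) e)); first exact: ler_sum.
by rewrite sumr_const card_ord mulr_natl.
Qed.

Variables (gamma rho : R).
Hypotheses (gamma_gt0 : 0 < gamma) (rho_ge0 : 0 <= rho).

Lemma continuous_holder_clamp X : holder0_ball gamma rho X ->
  continuous (X \o @clamp R k).
Proof.
move=> /(holder0_ballP _ _ gamma_gt0)[_ hX] t.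
move=> B /nbhs_ballP[e /= e0 eB]; apply/nbhs_ballP.
have e20 : 0 < e / 2 by rewrite divr_gt0.
have [N N0 hN] := small_modulus rho_ge0 gamma_gt0 (ler0n R k) e20.
have N0r : 0 < N%:R :> R by rewrite ltr0n.
exists N%:R^-1 => /=; first by rewrite invr_gt0.
move=> u [_ tu]; apply: eB; split => // i j; rewrite !ord1.
rewrite /ball/=; have := coord_le_enorm (X (clamp t) - X (clamp u)) j.
rewrite !mxE => /le_lt_trans; apply.
apply: (@le_lt_trans _ _ (e / 2)); last by rewrite ltr_pdivrMr// ltr_pMr// ltr1n.
apply: le_trans hN.
apply: (le_trans (hX _ _ (@clamp_unit_cube _ _ _) (@clamp_unit_cube _ _ _))).
rewrite ler_wpM2l// ge0_ler_powR ?nnegrE ?enorm_ge0 ?divr_ge0 ?(ltW gamma_gt0)//.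
apply: enorm_le_card => l; rewrite coordB.
apply: (le_trans (clamp_contraction _ _ _)).
by have := tu ord0 l; rewrite /ball/= => /ltW.
Qed.

Lemma measurable_holder_clamp X : holder0_ball gamma rho X ->
  measurable_fun setT (X \o @clamp R k : borel_rV R k -> borel_rV R n).
Proof.
move=> hX; apply: (@measurability _ _ (borel_rV R k) (borel_rV R n) setT _ (@open _) erefl).
move=> _ [U oU <-]; rewrite setTI; apply: sub_sigma_algebra.
apply: open_comp => // t _; exact: continuous_holder_clamp.
Qed.

(** An Arzela-Ascoli statement in cluster-point form: uniform closeness for arbitrarily late indices
    is all that is used, so no subsequence is extracted. *)
Lemma holder_ball_cluster (X_ : nat -> 'rV[R]_k -> 'rV[R]_n) :
  (forall m, holder0_ball gamma rho (X_ m)) ->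
  exists2 X, holder0_ball gamma rho X &
    forall (e : R) m0, 0 < e -> exists2 m, (m0 <= m)%N &
      forall t, unit_cube t -> enorm (X_ m t - X t) <= e.
Proof.
move=> hX_.
have X0 m : X_ m 0 = 0 by have /(holder0_ballP _ _ gamma_gt0)[] := hX_ m.
have hX m t u : unit_cube t -> unit_cube u ->
    enorm (X_ m t - X_ m u) <= rho * enorm (t - u) `^ gamma.
  by have /(holder0_ballP _ _ gamma_gt0)[_] := hX_ m; exact.
(* In the topology of pointwise convergence. All values lie in the compact box [-B, B]^n because the
   paths vanish at 0. *)
pose Z m : prod_topology (fun _ : 'rV[R]_k => 'rV[R]_n) := X_ m \o @clamp R k.
pose B := rho * k%:R `^ gamma.
pose A := [set v : 'rV[R]_n | forall i, `[- B, B]%classic (v ord0 i)].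
have cA : compact A.
  by apply: (@rV_compact _ _ (fun=> `[- B, B]%classic)) => _; exact: segment_compact.
have := @tychonoff _ (fun=> 'rV[R]_n) (fun=> A) (fun _ : 'rV[R]_k => cA).
move=> /(_ (Z @ \oo) _)[|f [_ clf]].
  exists 0%N => // m _ t i; rewrite /= in_itv/= -ler_norml.
  apply: (le_trans (coord_le_enorm _ _)).
  rewrite /Z /= -[X_ m _]subr0 -(X0 m).
  apply: (le_trans (hX _ _ _ (@clamp_unit_cube _ _ _) (@unit_cube0 _ _))).
  rewrite ler_wpM2l// ge0_ler_powR ?nnegrE ?enorm_ge0 ?(ltW gamma_gt0)//.
  rewrite -[leRHS]mulr1; apply: enorm_le_card => i'; rewrite subr0.
  have := @clamp_unit_cube _ _ t i'; rewrite in_itv/= => /andP[? ?].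
  by rewrite ger0_norm.
(* Closeness at finitely many points is a neighbourhood of [f] in the product topology, so it meets
   every tail of the sequence. *)
have key (pts : seq 'rV[R]_k) (e : R) m0 : 0 < e -> exists2 m, (m0 <= m)%N &
    forall p, p \in pts -> enorm (X_ m (clamp p) - f p) <= e.
  move=> e0; pose e' := e / n.+1%:R.
  have e'0 : 0 < e' by rewrite divr_gt0.
  have Fm0 : (Z @ \oo) [set g | exists2 m, (m0 <= m)%N & g = Z m].
    by exists m0 => // m /= m0m; exists m.
  have FF := @nbhs_filter (prod_topology (fun _ : 'rV[R]_k => 'rV[R]_n)) f.
  have nf : nbhs f [set g | forall p, p \in pts -> ball (f p) e' (g p)].
    elim: pts => [|p pts ih]; first by apply: (@filterE _ _ FF) => g p; rewrite in_nil.
    have np : nbhs f [set g | ball (f p) e' (g p)].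
      have := @proj_continuous _ (fun _ : 'rV[R]_k => 'rV[R]_n) p f.
      by apply; exact: nbhsx_ballx.
    apply: (@filterS _ _ FF _ _ _ (@filterI _ _ FF _ _ np ih)) => g /= [gp gpts] q.
    by rewrite in_cons => /predU1P[->//|]; exact: gpts.
  have [_ [[m m0m ->] /= hm]] := clf _ _ Fm0 nf.
  exists m => // p /hm [_ pm].
  apply: (@le_trans _ _ (n%:R * e')); last first.
    by rewrite /e' mulrCA ler_piMr ?(ltW e0)// ler_pdivrMr// mul1r ler_nat.
  apply: enorm_le_card => i; rewrite !mxE distrC.
  by have := pm ord0 i; rewrite /ball/= => /ltW.
have keyc e m0 t u : unit_cube t -> unit_cube u -> 0 < e -> exists2 m, (m0 <= m)%N &
    enorm (X_ m t - f t) <= e /\ enorm (X_ m u - f u) <= e.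
  move=> ct cu e0; have [m m0m hm] := key [:: t; u] e m0 e0.
  exists m => //; split.
    by have := hm t; rewrite clamp_id// mem_head; exact.
  by have := hm u; rewrite clamp_id// !inE eqxx orbT; exact.
have hf t u : unit_cube t -> unit_cube u ->
    enorm (f t - f u) <= rho * enorm (t - u) `^ gamma.
  move=> ct cu; apply/ler_addgt0Pr => e e0.
  have e20 : 0 < e / 2 by rewrite divr_gt0.
  have [m _ [mt mu]] := keyc _ 0%N _ _ ct cu e20.
  apply: (le_trans (enormB_trans (X_ m t) _ _)).
  apply: (le_trans (lerD (lexx _) (enormB_trans (X_ m u) _ _))).
  have := hX m _ _ ct cu; rewrite (enormBC (f t)); lra.
exists f.
  apply/holder0_ballP => //; split => //; apply/eqP; rewrite -enorm_eq0.
  rewrite eq_le enorm_ge0 andbT; apply/ler_addgt0Pr => e e0; rewrite add0r.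
  have [m _ [+ _]] := keyc _ 0%N _ _ (@unit_cube0 R k) (@unit_cube0 R k) e0.
  by rewrite X0 sub0r enormN.
move=> e m0 e0; have e30 : 0 < e / 3 by rewrite divr_gt0.
have [N N0 hN] := small_modulus rho_ge0 gamma_gt0 (ler0n R k) e30.
have N0r : 0 < N%:R :> R by rewrite ltr0n.
pose pt (g : {ffun 'I_k -> 'I_N.+1}) : 'rV[R]_k := \row_i ((g i)%:R / N%:R).
have cpt g : unit_cube (pt g).
  move=> i; rewrite mxE in_itv/= divr_ge0//= ler_pdivrMr// mul1r ler_nat.
  by rewrite -ltnS.
have [m m0m hm] := key [seq pt g | g <- enum {ffun 'I_k -> 'I_N.+1}] _ m0 e30.
exists m => // t ct; have [g gt] := unit_cube_grid N0 ct.
(* Closeness at the grid points extends to the cube: the common modulus of [X_ m] and [f] costs e/3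
   each between [t] and its grid point. *)
have tp : rho * enorm (t - pt g) `^ gamma <= e / 3.
  apply: le_trans hN; rewrite ler_wpM2l// ge0_ler_powR ?nnegrE ?enorm_ge0 ?divr_ge0//.
    exact: ltW.
  by apply: enorm_le_card => i; rewrite !mxE.
have := hm (pt g); rewrite map_f ?mem_enum// clamp_id// => /(_ erefl) hmg.
apply: (le_trans (enormB_trans (X_ m (pt g)) _ _)).
apply: (le_trans (lerD (lexx _) (enormB_trans (f (pt g)) _ _))).
have := hX m _ _ ct (cpt g); have := hf _ _ (cpt g) ct.
rewrite (enormBC (pt g)); lra.
Qed.

End holder_ball.

(** * Existence of minimizers *)

Section cube_measure.
Variables (R : realType) (k : nat).

Lemma lebesgue_unit_cube : lebesgue_rV R k unit_cube = 1%E.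
Proof.
rewrite lebesgue_rV_box big1// => i _.
by rewrite lebesgue_measure_itv/= lte_fin ltr01 oppr0 adde0.
Qed.

Lemma lebesgue_unit_cube_lty : (lebesgue_rV R k unit_cube < +oo)%E.
Proof. by rewrite lebesgue_unit_cube ltry. Qed.

(** Lebesgue measure restricted to the cube but carried by the whole space, to match the total maps
    [X \o @clamp R k]. *)
Definition cube_measure : {finite_measure set (borel_rV R k) -> \bar R} :=
  mfrestr (@measurable_box R k (fun=> `[0, 1])) lebesgue_unit_cube_lty.

Lemma cube_measureE A : cube_measure A = lebesgue_rV R k (A `&` unit_cube).
Proof. by []. Qed.

Lemma cube_measureT : cube_measure setT = 1%E.
Proof. by rewrite cube_measureE setTI lebesgue_unit_cube. Qed.

End cube_measure.

Section energy_in_ball.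
Variables (R : realType) (k n : nat) (alpha gamma rho : R).
Hypotheses (alpha_ltn : alpha < n%:R) (gamma_gt0 : 0 < gamma) (rho_ge0 : 0 <= rho).
Implicit Types X : 'rV[R]_k -> 'rV[R]_n.

Local Notation P := (cube_measure R k).
Local Notation ball_ := (@holder0_ball R k n gamma rho).

Lemma occupation_measureE X : occupation_measure X =
  pushforward P (X \o @clamp R k : borel_rV R k -> borel_rV R n).
Proof.
apply/funext => B; rewrite /occupation_measure /pushforward cube_measureE.
congr (lebesgue_rV R k _); apply/seteqP; split => t /= [].
  by move=> ct Bt; split => //; rewrite clamp_id.
by move=> + ct; rewrite clamp_id.
Qed.

Lemma riesz_energy_occupation X : ball_ X ->
  riesz_energy alpha (occupation_measure X) =
  riesz_energy_prod P alpha (X \o @clamp R k : borel_rV R k -> borel_rV R n).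
Proof.
move=> hX; rewrite occupation_measureE riesz_energy_pushforward//.
exact: measurable_holder_clamp hX.
Qed.

(** Serves twice: to pass from uniformly bounded regularised energies to a path of finite energy,
    and to obtain a minimizer. *)
Lemma riesz_energy_le_of_approx (c : R) :
  (forall e d : R, 0 < e -> 0 < d -> exists2 X, ball_ X &
    (reg_energy P alpha (X \o @clamp R k : borel_rV R k -> borel_rV R n) d
      <= (c + e)%:E)%E) ->
  exists2 X, ball_ X & (riesz_energy alpha (occupation_measure X) <= c%:E)%E.
Proof.
move=> h.
have /choice[X_ hX_] (m : nat) : exists X, ball_ X /\
    (reg_energy P alpha (X \o @clamp R k : borel_rV R k -> borel_rV R n)
      m.+1%:R^-1 <= (c + m.+1%:R^-1)%:E)%E.
  have m0 : 0 < m.+1%:R^-1 :> R by rewrite invr_gt0.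
  by have [X ? ?] := h _ _ m0 m0; exists X.
have bX_ m : ball_ (X_ m) by have [] := hX_ m.
have [X hX clX] := holder_ball_cluster gamma_gt0 rho_ge0 bX_.
have mX := measurable_holder_clamp gamma_gt0 rho_ge0 hX.
exists X => //; rewrite riesz_energy_occupation//.
apply: riesz_energy_le_reg => // d d0; apply/lee_addgt0Pr => e e0.
rewrite -EFinD.
(* With 1/(m+1) <= d/2 and |X_m - X| <= d/4 on the cube, |X_m(a) - X_m(b)| + 1/(m+1) <= |X(a) -
   X(b)| + d. Hence E_d(X) is at most the regularised energy of X_m, that is, at most c + 1/(m+1) <=
   c + e. *)
pose r := Num.min e (d / 2).
have r0 : 0 < r by rewrite lt_min e0 divr_gt0.
have [m m0m hm] := clX (d / 4) (Num.truncn r^-1) (divr_gt0 d0 (ltr0n _ 4)).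
have mr : m.+1%:R^-1 <= r.
  rewrite -[leRHS]invrK lef_pV2 ?posrE ?invr_gt0//.
  by apply: (le_trans (ltW (truncnS_gt _))); rewrite ler_nat ltnS.
have [_ Em] := hX_ m.
have mXm := measurable_holder_clamp gamma_gt0 rho_ge0 (bX_ m).
apply: (@le_trans _ _ (c + m.+1%:R^-1)%:E); last first.
  by rewrite lee_fin lerD2l (le_trans mr)// ge_min lexx.
apply: le_trans Em; apply: ge0_le_integral => //.
- by move=> z _; rewrite lee_fin reg_kernel_ge0.
- exact: measurable_reg_kernel.
- exact: measurable_reg_kernel.
move=> z _; rewrite lee_fin; apply: reg_kernel_le; rewrite ?subr_ge0 ?(ltW alpha_ltn)//.
have mr2 : m.+1%:R^-1 <= d / 2 by rewrite (le_trans mr)// ge_min lexx orbT.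
rewrite /=; set a := clamp z.1; set b := clamp z.2.
have ha := hm a (@clamp_unit_cube _ _ _); have hb := hm b (@clamp_unit_cube _ _ _).
have := enormB_trans (X a) (X_ m a) (X_ m b).
have := enormB_trans (X b) (X a) (X_ m b).
rewrite (enormBC (X b)) => h1 h2.
change (enorm (X_ m a - X_ m b) + m.+1%:R^-1 <= enorm (X a - X b) + d).
move: ha hb h1 h2 mr2; rewrite {}/a {}/b.
move: (enorm _) (enorm _) (enorm _) (enorm _) (enorm _) (m.+1%:R^-1).
move=> *; lra.
Qed.

Lemma exists_riesz_minimizer (c : R) :
  (exists2 X, ball_ X & (riesz_energy alpha (occupation_measure X) <= c%:E)%E) ->
  exists X, minimizes (fun X => riesz_energy alpha (occupation_measure X)) ball_ X.
Proof.
move=> [X0 hX0 E0].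
pose En X := riesz_energy alpha (occupation_measure X).
have En0 X : ball_ X -> (0 <= En X)%E.
  move=> hX; rewrite /En riesz_energy_occupation//.
  by apply: integral_ge0 => z _; exact: riesz_kernel_ge0.
pose I := ereal_inf (En @` ball_).
have I0 : (0 <= I)%E by apply: le_ereal_inf_tmp => _ [X hX <-]; exact: En0.
have Ic : (I <= c%:E)%E by apply: le_trans E0; apply: ereal_inf_lbound; exists X0.
have IE : I = (fine I)%:E by rewrite fineK// ge0_fin_numE// (le_lt_trans Ic)// ltry.
have [|X hX EX] := @riesz_energy_le_of_approx (fine I).
  move=> e d e0 d0; have : (I < (fine I + e)%:E)%E by rewrite {1}IE lte_fin ltrDl.
  move=> /ereal_inf_lt[_ [X hX <-] /ltW XI]; exists X => //.
  apply: le_trans XI; rewrite /En riesz_energy_occupation//.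
  apply: reg_energy_le_riesz => //.
  exact: measurable_holder_clamp hX.
exists X; split => // Y hY; apply: (le_trans EX); rewrite -IE.
by apply: ereal_inf_lbound; exists Y.
Qed.

End energy_in_ball.

(** * Paths of finite energy *)

Section trig.
Variable R : realType.
Implicit Types x y : R.

Definition trig (b : bool) x : R := if b then sin x else cos x.

Lemma trig_lipschitz b x y : `|trig b x - trig b y| <= `|x - y|.
Proof.
wlog xy : x y / x <= y.
  by move=> h; case: (leP x y) => [/h//|/ltW/h]; rewrite distrC (distrC y).
pose df (z : R) : R := if b then cos z else - sin z.
have dt (z : R) : is_derive z 1 (trig b) (df z).
  by rewrite /trig /df; destruct b; [exact: is_derive_sin|exact: is_derive_cos].
have [|c _] := MVT_segment (f := trig b) (df := df) xy (fun z _ => dt z).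
  apply: derivable_within_continuous => z _; exact: ex_derive.
move=> e; rewrite (distrC (trig b x)) e normrM (distrC x) ler_piMl//.
by rewrite /df; case: ifP => _; rewrite ?normrN ?cos_max ?sin_max.
Qed.

Lemma trig_dist_le2 b x y : `|trig b x - trig b y| <= 2.
Proof.
rewrite (le_trans (ler_normB _ _))// (_ : 2 = 1 + 1)//.
by rewrite lerD// /trig; case: b; rewrite ?cos_max ?sin_max.
Qed.

(** Interpolates between the Lipschitz bound, for increments at most 1, and the trivial bound 2. *)
Lemma trig_holder b x y (g : R) : 0 <= g <= 1 ->
  `|trig b x - trig b y| <= 2 * `|x - y| `^ g.
Proof.
move=> /andP[g0 g1]; have [xy1|xy1] := leP `|x - y| 1; last first.
  apply: (le_trans (trig_dist_le2 _ _ _)); rewrite ler_peMr//.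
  have h : 1 `^ g = 1 :> R by rewrite powR1.
  by rewrite -[leLHS]h ge0_ler_powR ?nnegrE// ltW.
have [->|xy] := eqVneq x y; first by rewrite subrr normr0 mulr_ge0// powR_ge0.
apply: (le_trans (trig_lipschitz _ _ _)).
apply: (@le_trans _ _ (`|x - y| `^ g)).
  by rewrite ger1_powR// xy1 normr_gt0 subr_eq0 xy.
by rewrite ler_peMl ?powR_ge0// ler1n.
Qed.

(* (sin x - sin y)^2 + (cos x - cos y)^2 = 2 - 2 cos (x - y) *)
Lemma trig_separation : exists2 c : R, 0 < c & forall x y,
  2^-1 <= `|x - y| <= 1 -> exists b, c <= `|trig b x - trig b y|.
Proof.
have half_pi : 2^-1 \in `[0, pi :> R].
  rewrite in_itv/= invr_ge0 ler0n/= (le_trans _ (pi_ge2 R))//; lra.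
have d0 : 0 < 1 - cos 2^-1 :> R.
  rewrite subr_gt0 -[ltRHS](@cos0 R) ltr_cos// ?invr_gt0//.
  by rewrite in_itv/= lexx pi_ge0.
exists (Num.sqrt (1 - cos 2^-1)); first by rewrite sqrtr_gt0.
move=> x y /andP[xy1 xy2]; apply: contrapT => /forallNP h.
have cxy : cos (x - y) <= cos 2^-1.
  have -> : cos (x - y) = cos `|x - y|.
    by case: (ger0P (x - y)) => _; rewrite ?cosN.
  have [->//|xyh] := eqVneq `|x - y| 2^-1.
  rewrite ltW// ltr_cos//; first by rewrite lt_neqAle eq_sym xyh.
  by rewrite in_itv/= normr_ge0/= (le_trans xy2)// (le_trans _ (pi_ge2 R))// ler1n.
(* Added for sine and cosine, these contradict 2 - 2 cos (x - y) >= 2 - 2 cos (1/2). *)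
have hb b : (trig b x - trig b y) ^+ 2 < 1 - cos 2^-1.
  rewrite -(sqr_sqrtr (ltW d0)) -real_normK ?num_real//.
  by rewrite ltr_pXn2r ?nnegrE ?sqrtr_ge0// ltNge; apply/negP; exact: h.
have := hb true; have := hb false; rewrite /trig.
have := cos2Dsin2 x; have := cos2Dsin2 y; have := cosB x y; move: cxy.
move: (sin x) (sin y) (cos x) (cos y) (cos (x - y)) (cos 2^-1) => a b c d e f.
move=> *; nra.
Qed.

End trig.

Lemma sum_expr_le (R : realFieldType) (x : R) J : 0 <= x < 1 ->
  \sum_(j < J) x ^+ j <= (1 - x)^-1.
Proof.
move=> /andP[x0 x1]; have h : 0 < 1 - x by rewrite subr_gt0.
rewrite -[leRHS]mul1r ler_pdivlMr// mulrC.
have := subrX1 x J; have := exprn_ge0 J x0; set s := \sum_(_ < _) _; nra.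
Qed.

(** * Averages of |x|^(-b), 0 < b < 1, over arithmetic progressions *)

Section negative_power_average.
Variables (R : realType) (b : R).
Hypothesis b01 : 0 < b < 1.

Lemma sum_powRN_le M :
  \sum_(q < M) q.+1%:R `^ (- b) <= M%:R `^ (1 - b) / (1 - b).
Proof.
have /andP[b0 b1] := b01; have c0 : 0 < 1 - b by rewrite subr_gt0.
elim: M => [|M ih].
  by rewrite big_ord0 divr_ge0 ?powR_ge0// ltW.
rewrite big_ord_recr/= (le_trans (lerD ih (lexx _)))//.
rewrite -lerBrDl -mulrBl ler_pdivlMr//.
have a0 : 0 < M.+1%:R :> R by rewrite ltr0n.
(* Young's inequality: M^(1-b) (M+1)^b <= (1-b) M + b (M+1) = M + b. Multiplied by (M+1)^(-b), this
   is the induction step. *)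
have := @conjugate_powR R (M%:R `^ (1 - b)) (M.+1%:R `^ b) (1 - b)^-1 b^-1
  (powR_ge0 _ _) (powR_ge0 _ _).
rewrite !invr_gt0 !invrK => /(_ c0 b0); rewrite subrK => /(_ erefl).
rewrite -!powRrM !divff ?gt_eqF// !powRr1// -natr1 => h.
have e1 : (M%:R + 1) `^ b * (M%:R + 1) `^ (- b) = 1 :> R.
  by rewrite -powRD ?subrr ?powRr0//; rewrite natr1 pnatr_eq0 implybT.
have e2 : (M%:R + 1) `^ (1 - b) = (M%:R + 1) * (M%:R + 1) `^ (- b) :> R.
  rewrite powRD ?powRr1 ?addr_ge0//; rewrite natr1 pnatr_eq0 implybT//.
rewrite e2.
have p0 : 0 < (M%:R + 1) `^ (- b) :> R by rewrite powR_gt0// natr1.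
move: h; rewrite -(ler_pM2r p0) -mulrA e1; nra.
Qed.

(** Cut the range at an index [m0] next to [x]. On each side the distances to [x] dominate 0, 1, 2,
    ..., so each side is at most the centred sum. *)
Lemma sum_powRN_shift (h d x : R) M : 0 < h -> 0 < d ->
  \sum_(m < M) (h * `|m%:R - x| + d) `^ (- b) <=
  2 * \sum_(q < M) (h * q%:R + d) `^ (- b).
Proof.
move=> h0 d0; have /andP[b0 b1] := b01.
pose G (q : nat) := (h * q%:R + d) `^ (- b).
have GF (q m : nat) : q%:R <= `|m%:R - x| -> (h * `|m%:R - x| + d) `^ (- b) <= G q.
  move=> qm; apply: ler_powRN; first exact: ltW.
  - by rewrite ltr_wpDl// mulr_ge0// ltW.
  - by rewrite lerD2r ler_pM2l.
have [m0 m0M [hl hr]] : exists2 m0, (m0 <= M)%N &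
    (forall m, (m < m0)%N -> (m0 - m.+1)%:R <= `|m%:R - x|) /\
    (forall m, (m0 <= m < M)%N -> (m - m0)%:R <= `|m%:R - x|).
  have [x0|x0] := ltP x 0.
    exists 0%N => //; split => // m _; rewrite subn0.
    by apply: le_trans (ler_norm _); rewrite lerDl oppr_ge0 ltW.
  have /andP[t1 t2] := truncn_itv x0; move: (Num.truncn x) t1 t2 => p t1 t2.
  have hl (m0 m : nat) : (m0 <= p.+1)%N -> (m < m0)%N -> (m0 - m.+1)%:R <= `|m%:R - x|.
    move=> m0p mm0; rewrite distrC; apply: le_trans (ler_norm _).
    rewrite natrB// lerBlDr -natr1.
    have : m0%:R <= p%:R + 1 :> R by rewrite natr1 ler_nat.
    lra.
  have [pM|Mp] := leqP p.+1 M.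
    exists p.+1 => //; split => m; first exact: hl.
    move=> /andP[pm mM]; apply: le_trans (ler_norm _).
    by rewrite natrB// lerD2l lerN2 ltW.
  exists M => //; split => m; first by apply: hl; exact: ltnW.
  by rewrite leqNgt andNb.
rewrite -(big_mkord xpredT (fun m => (h * `|m%:R - x| + d) `^ (- b))).
rewrite (big_cat_nat (leq0n m0) m0M)//= mulr_natl mulr2n.
have Gsum N : (N <= M)%N -> \sum_(0 <= q < N) G q <= \sum_(q < M) G q.
  move=> NM; rewrite -(big_mkord xpredT G) [leRHS](big_cat_nat (leq0n N) NM)//= lerDl.
  by rewrite sumr_ge0// => q _; exact: powR_ge0.
apply: lerD.
  apply: le_trans (Gsum m0 m0M); rewrite [leRHS]big_nat_rev/= add0n.
  rewrite !big_nat; apply: ler_sum => m /andP[_ mm0]; apply: GF; exact: hl.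
apply: le_trans (Gsum (M - m0)%N (leq_subr _ _)).
rewrite -{1}(add0n m0) big_addn !big_nat; apply: ler_sum => m /andP[_ mM].
apply: GF; have := hr (m + m0)%N; rewrite addnK; apply.
by rewrite leq_addl/= addnC -ltn_subRL.
Qed.

(** The average is bounded uniformly in [z] and [d], provided the grid is fine enough for a single
    term d^(-b) to be harmless. *)
Lemma average_powRN (c d z : R) M : c != 0 -> 0 < d -> (0 < M)%N ->
  d `^ (- b) <= M%:R * `|c| `^ (- b) ->
  \sum_(m < M) (`|z + c * (m%:R / M%:R)| + d) `^ (- b) <=
  M%:R * (2 * (1 + (1 - b)^-1) * `|c| `^ (- b)).
Proof.
move=> c0 d0; case: M => // M _ dM; have /andP[b0 b1] := b01.
have Mr : 0 < M.+1%:R :> R by rewrite ltr0n.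
have cn : 0 < `|c| by rewrite normr_gt0.
pose h := `|c| / M.+1%:R; have h0 : 0 < h by rewrite divr_gt0.
pose x := - z * M.+1%:R / c.
rewrite (eq_bigr (fun m : 'I_M.+1 => (h * `|m%:R - x| + d) `^ (- b))); last first.
  move=> m _; congr ((_ + _) `^ _).
  rewrite /h -[in RHS](gtr0_norm Mr) -normfV -!normrM; congr (`|_|).
  by rewrite /x; field; rewrite c0 gt_eqF.
apply: (le_trans (sum_powRN_shift _ _ h0 d0)).
rewrite (_ : M.+1%:R * _ = 2 * (M.+1%:R * `|c| `^ (- b) +
  M.+1%:R * `|c| `^ (- b) * (1 - b)^-1)); last by ring.
(* The term q = 0 is d^(-b), bounded by [dM]; in the other terms [d] is dropped. *)
rewrite ler_pM2l// big_ord_recl mulr0 add0r lerD//.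
apply: (@le_trans _ _ (h `^ (- b) * \sum_(q < M) q.+1%:R `^ (- b))).
  rewrite mulr_sumr; apply: ler_sum => q _ /=.
  rewrite -powRM ?(ltW h0)//; apply: ler_powRN; first exact: ltW.
  - by rewrite mulr_gt0.
  - by rewrite lerDl ltW.
have hE : h `^ (- b) * M.+1%:R `^ (1 - b) = M.+1%:R * `|c| `^ (- b).
  rewrite /h powRM ?invr_ge0 ?(ltW Mr)//.
  rewrite -[M.+1%:R^-1]powR_inv1 ?(ltW Mr)// -powRrM mulN1r opprK -mulrA -powRD.
    by rewrite addrC subrK powRr1 ?(ltW Mr)// mulrC.
  by rewrite pnatr_eq0 implybT.
rewrite -hE -mulrA ler_wpM2l ?powR_ge0//.
apply: (le_trans (sum_powRN_le _)).
rewrite ler_pM2r ?invr_gt0 ?subr_gt0//.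
by rewrite ge0_ler_powR ?nnegrE ?subr_ge0 ?ler_nat ?(ltW b1).
Qed.

End negative_power_average.

(** * Averages over finite grids of coefficients *)

Section grid_average.
Variables (R : realType) (L : finType) (M : nat).
Local Notation A := {ffun L -> 'I_M}.

(** Exchanging [m] with the value [a l0] is an involution on the pairs (a, m). *)
Lemma sum_ffun_update (G : A -> R) (l0 : L) :
  \sum_(a : A) \sum_(m < M) G [ffun l => if l == l0 then m else a l] =
  M%:R * \sum_(a : A) G a.
Proof.
rewrite pair_big/=.
pose h (p : A * 'I_M) : A * 'I_M :=
  ([ffun l => if l == l0 then p.2 else p.1 l], p.1 l0).
have hK : involutive h.
  move=> [a m]; rewrite /h /= ffunE eqxx; congr pair; apply/ffunP => l.
  by rewrite !ffunE; case: eqP => // ->.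
rewrite (reindex_inj (inv_inj hK))/=.
transitivity (\sum_(p : A * 'I_M) G p.1).
  apply: eq_bigr => p _; congr G; apply/ffunP => l.
  by rewrite !ffunE; case: eqP => // ->.
rewrite -(pair_big xpredT xpredT (fun a (_ : 'I_M) => G a))/= mulr_sumr.
by apply: eq_bigr => a _; rewrite sumr_const card_ord mulr_natl.
Qed.

(** A discrete Fubini argument: with the other coefficients frozen into [z], averaging over the
    coefficient [l0] alone gives the bound. *)
Lemma sum_ffun_le (g : R -> R) (c : L -> R) (l0 : L) (B : R) : (0 < M)%N ->
  (forall z, \sum_(m < M) g (z + c l0 * (m%:R / M%:R)) <= M%:R * B) ->
  \sum_(a : A) g (\sum_l c l * ((a l)%:R / M%:R)) <= #|A|%:R * B.
Proof.
move=> M0 hg; have Mr : 0 < M%:R :> R by rewrite ltr0n.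
rewrite -(ler_pM2l Mr) -(sum_ffun_update _ l0) mulrCA.
apply: (@le_trans _ _ (\sum_(a : A) (M%:R * B))); last first.
  by rewrite sumr_const [leRHS]mulr_natl.
apply: ler_sum => a _.
rewrite (eq_bigr (fun m : 'I_M => g (\sum_(l | l != l0) c l * ((a l)%:R / M%:R) +
  c l0 * (m%:R / M%:R)))); first exact: hg.
move=> m _; congr g; rewrite (bigD1 l0)//= ffunE eqxx addrC; congr +%R.
by apply: eq_bigr => l /negbTE ll0; rewrite ffunE ll0.
Qed.

Lemma reg_kernel_le_prod (n : nat) (s d : R) (x : 'rV[R]_n) :
  (0 < n)%N -> 0 <= s -> 0 < d ->
  reg_kernel s d x <= \prod_(i < n) (`|x ord0 i| + d) `^ (- (s / n%:R)).
Proof.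
move=> n0 s0 d0; have nr : 0 < n%:R :> R by rewrite ltr0n.
apply: (@le_trans _ _ (\prod_(i < n) (enorm x + d) `^ (- (s / n%:R)))).
  rewrite prodr_const card_ord /reg_kernel -powR_mulrn ?powR_ge0// -powRrM.
  by rewrite mulNr divfK// gt_eqF.
apply: ler_prod => i _; rewrite powR_ge0/=; apply: ler_powRN.
- by rewrite divr_ge0.
- by rewrite ltr_wpDl.
- by rewrite lerD2r coord_le_enorm.
Qed.

Lemma sum_reg_kernel_grid_le (n : nat) (s d : R) (c : L -> R) (l0 : L) :
  0 < s < n%:R -> 0 < d -> (0 < M)%N -> c l0 != 0 ->
  d `^ (- (s / n%:R)) <= M%:R * `|c l0| `^ (- (s / n%:R)) ->
  \sum_(a : {ffun 'I_n -> A})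
    reg_kernel s d (\row_i \sum_l c l * ((a i l)%:R / M%:R)) <=
  #|{ffun 'I_n -> A}|%:R *
    ((2 * (1 + (1 - s / n%:R)^-1)) ^+ n * `|c l0| `^ (- s)).
Proof.
move=> /andP[s0 sn] d0 M0 c0 dM.
have n0 : (0 < n)%N by rewrite -(ltr_nat R) (lt_trans s0).
have nr : 0 < n%:R :> R by rewrite ltr0n.
have b01 : 0 < s / n%:R < 1 by rewrite divr_gt0//= ltr_pdivrMr// mul1r.
set b := s / n%:R in b01 dM *; set C := 2 * _.
apply: (@le_trans _ _ (\sum_(a : {ffun 'I_n -> A}) \prod_(i < n)
    (`|\sum_l c l * ((a i l)%:R / M%:R)| + d) `^ (- b))).
  apply: ler_sum => a _.
  apply: (le_trans (reg_kernel_le_prod _ n0 (ltW s0) d0)).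
  by under eq_bigr do rewrite mxE.
(* The n coordinates have independent coefficients, so the sum of products is a product of sums. *)
rewrite -(bigA_distr_bigA (fun (_ : 'I_n) (a : A) =>
  (`|\sum_l c l * ((a l)%:R / M%:R)| + d) `^ (- b))) /=.
apply: (@le_trans _ _ (\prod_(i < n) (#|A|%:R * (C * `|c l0| `^ (- b))))).
  apply: ler_prod => i _; rewrite sumr_ge0/=; last by move=> *; exact: powR_ge0.
  by apply: (sum_ffun_le (g := fun y => (`|y| + d) `^ (- b))) => // z; exact: average_powRN.
rewrite prodr_const card_ord [X in _ <= X%:R * _]card_ffun natrX card_ord !exprMn.
by rewrite -[(_ `^ _) ^+ n]powR_mulrn ?powR_ge0// -powRrM mulNr divfK// gt_eqF.
Qed.

End grid_average.

(** Pigeonhole: exchanging the sum over [A] with the integral bounds the mean of the energies by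
    [w], so they cannot all exceed it. *)
Lemma exists_reg_energy_le (R : realType) (n : nat) d (T : measurableType d)
    (P : {finite_measure set T -> \bar R}) (alpha e w : R) (A : finType)
    (Y : A -> T -> borel_rV R n) (W : T * T -> R) :
  (0 < #|A|)%N -> (forall a, measurable_fun setT (Y a)) ->
  measurable_fun setT W -> (forall z, 0 <= W z) ->
  (forall z, \sum_a reg_kernel (n%:R - alpha) e (Y a z.1 - Y a z.2 : 'rV[R]_n)
     <= #|A|%:R * W z) ->
  (\int[P \x P]_z (W z)%:E <= w%:E)%E ->
  exists a, (reg_energy P alpha (Y a) e <= w%:E)%E.
Proof.
move=> A0 mY mW W0 hW intW; apply: contrapT => /forallNP h.
have Ar : 0 < #|A|%:R :> R by rewrite ltr0n.
have mEW : measurable_fun setT (fun z => (W z)%:E) by apply/measurable_EFinP.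
have : (\sum_(a : A) reg_energy P alpha (Y a) e <= (#|A|%:R * w)%:E)%E.
  rewrite -ge0_integral_sum//; last 2 first.
  - by move=> a; exact: measurable_reg_kernel.
  - by move=> a z _; rewrite lee_fin reg_kernel_ge0.
  apply: (@le_trans _ _ (\int[P \x P]_z (#|A|%:R%:E * (W z)%:E))%E).
    apply: ge0_le_integral => //.
    - by move=> z _; apply: sume_ge0 => a _; rewrite lee_fin reg_kernel_ge0.
    - by apply: emeasurable_sum => a; exact: measurable_reg_kernel.
    - exact: emeasurable_funM.
    - by move=> z _; rewrite sumEFin -EFinM lee_fin.
  rewrite ge0_integralZl//; last by move=> z _; rewrite lee_fin.
  by rewrite EFinM lee_pmul2l// lte_fin.
apply/negP; rewrite -ltNge.
have -> : (#|A|%:R * w)%:E = (\sum_(a : A) w%:E)%E :> \bar R.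
  by rewrite sumEFin sumr_const mulr_natl.
have /card_gt0P[a0 _] := A0.
rewrite (bigD1 a0)//= [ltRHS](bigD1 a0)//=.
have lt a : (w%:E < reg_energy P alpha (Y a) e)%E by rewrite ltNge; apply/negP; exact: h.
apply: lte_leD => //; first by rewrite sumEFin.
by apply: lee_sum => a _; exact: ltW.
Qed.

(** In the second case 2^j |x_i| lies in (1/2, 1], where [trig_separation] applies. The first case
    is the remainder near the diagonal. *)
Lemma dyadic_separation (R : realType) (k J : nat) (x : 'rV[R]_k) :
  (forall i, `|x ord0 i| <= 1) ->
  (forall i, `|x ord0 i| <= (2 ^+ J)^-1) \/
  exists j : 'I_J, (forall i, `|x ord0 i| <= (2 ^+ j)^-1) /\
    exists i, (2 ^+ j.+1)^-1 < `|x ord0 i|.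
Proof.
move=> x1; elim: J => [|J [xJ|[j [xj [i xi]]]]].
- by left => i; rewrite expr0 invr1.
- have [h|h] := pselect (exists i, (2 ^+ J.+1)^-1 < `|x ord0 i|).
    by right; exists ord_max.
  by left => i; rewrite leNgt; apply/negP => xi; apply: h; exists i.
- by right; exists (widen_ord (leqnSn J) j); split => //; exists i.
Qed.

(** * Measure of the pairs of parameters at small distance *)

Section close_pairs.
Variables (R : realType) (k : nat).
Local Notation P := (cube_measure R k).

Definition close_pairs (r : R) : set (borel_rV R k * borel_rV R k) :=
  [set z | enorm (clamp z.1 - clamp z.2 : 'rV[R]_k) <= r].

Lemma measurable_clamp :
  measurable_fun setT (@clamp R k : borel_rV R k -> borel_rV R k).
Proof.
have := @measurable_holder_clamp R k k 1 1 ltr01 ler01 id; apply.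
apply/holder0_ballP => //; split => // t u _ _.
by rewrite mul1r powRr1// enorm_ge0.
Qed.

Lemma measurable_close_pairs r : measurable (close_pairs r).
Proof.
rewrite -[close_pairs r]setTI.
rewrite (_ : close_pairs r =
  (fun z => enorm (clamp z.1 - clamp z.2 : 'rV[R]_k)) @^-1` `]-oo, r]).
  by apply: (measurable_enormB measurable_clamp) => //; exact: measurable_itv.
by apply/seteqP; split => z; rewrite /close_pairs /= in_itv.
Qed.

Lemma close_pairs_le (r : R) : 0 <= r ->
  ((P \x P) (close_pairs r) <= ((2 * r) ^+ k)%:E)%E.
Proof.
move=> r0; rewrite /product_measure1.
apply: (@le_trans _ _ (\int[P]_x ((2 * r) ^+ k)%:E)%E); last first.
  rewrite (integral_cst P measurableT) [X in (_ * X)%E](_ : _ = 1%E) ?mule1//.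
  exact: cube_measureT.
apply: ge0_le_integral => //.
- by apply: measurable_fun_xsection; exact: measurable_close_pairs.
- move=> t _ /=; rewrite cube_measureE.
  pose J (i : 'I_k) := `[clamp t ord0 i - r, clamp t ord0 i + r].
  apply: (@le_trans _ _ (lebesgue_rV R k (box J))).
    rewrite le_measure ?inE//; last 2 first.
    - exact: measurable_box.
    - move=> u [/xsectionP + cu] i; rewrite /close_pairs/= (clamp_id cu) => h.
      have := le_trans (coord_le_enorm _ i) h; rewrite coordB.
      by rewrite in_itv/= ler_distlC => /andP[? ?]; apply/andP; split; lra.
    apply: measurableI; last exact: measurable_box.
    by apply: measurable_xsection; exact: measurable_close_pairs.
  rewrite lebesgue_rV_box (eq_bigr (fun=> (2 * r)%:E)); last first.
    move=> i _; rewrite lebesgue_measure_itv/= lte_fin.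
    case: ifPn => [_|]; first by rewrite -EFinB; congr EFin; ring.
    by rewrite -leNgt => h; congr EFin; lra.
  by rewrite prodEFin prodr_const card_ord.
Qed.

End close_pairs.

Lemma powR2_lt1 (R : realType) (x : R) : x < 0 -> 2 `^ x < 1.
Proof.
move=> x0; rewrite /powR pnatr_eq0/= expR_lt1 nmulr_rlt0// ln_gt0// ltr1n//.
Qed.

(* Weierstrass-type sums X(t)_i = sum_l phi_l(t) a_(i,l) / M over frequencies
   2^j, j < J, with coefficients a_(i,l) / M on a grid of [0, 1]; l records the
   frequency, the coordinate of t, and the choice between sine and cosine. *)
Section grid_path.
Variables (R : realType) (k n : nat) (gamma rho g' : R).
Hypotheses (k_gt0 : (0 < k)%N) (n_gt0 : (0 < n)%N) (rho_gt0 : 0 < rho).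
Hypotheses (gamma_gt0 : 0 < gamma) (gamma_lt1 : gamma < 1) (gg' : gamma < g').

Let lam : R := 2 `^ (- g').
(** Equals lam 2^gamma, the ratio of the geometric series formed by the Hoelder constants of
    successive frequencies. *)
Let nu : R := 2 `^ (gamma - g').
(** Normalised so that the 2k modes per frequency, each with Hoelder constant at most 2 kap nu^j,
    add up to at most rho/n in each coordinate. *)
Definition grid_amplitude : R := rho * (1 - nu) / (4 * k%:R * n%:R).
Local Notation kap := grid_amplitude.

Let lam_gt0 : 0 < lam. Proof. exact: powR_gt0. Qed.
Let lam_lt1 : lam < 1.
Proof. by apply: powR2_lt1; rewrite oppr_lt0 (lt_trans gamma_gt0). Qed.
Let nu_gt0 : 0 < nu. Proof. exact: powR_gt0. Qed.
Let nu_lt1 : nu < 1. Proof. by apply: powR2_lt1; rewrite subr_lt0. Qed.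

Lemma grid_amplitude_gt0 : 0 < kap.
Proof.
by rewrite divr_gt0// ?mulr_gt0 ?subr_gt0 ?ltr0n.
Qed.
Let kap_gt0 := grid_amplitude_gt0.

Variable J : nat.
Local Notation L := ('I_J * 'I_k * bool)%type.

(** The value at 0 is subtracted to make the path vanish at the origin. *)
Definition grid_mode (l : L) (t : 'rV[R]_k) : R :=
  kap * lam ^+ l.1.1 *
    (trig l.2 (2 ^+ l.1.1 * t ord0 l.1.2) - trig l.2 0).

Definition grid_path M (a : {ffun 'I_n -> {ffun L -> 'I_M}}) (t : 'rV[R]_k) :
    'rV[R]_n :=
  \row_i \sum_l grid_mode l t * ((a i l)%:R / M%:R).

Lemma grid_modeB l t u : grid_mode l t - grid_mode l u =
  kap * lam ^+ l.1.1 * (trig l.2 (2 ^+ l.1.1 * t ord0 l.1.2) -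
    trig l.2 (2 ^+ l.1.1 * u ord0 l.1.2)).
Proof. by rewrite /grid_mode; ring. Qed.

Lemma grid_modeB_norm l t u : `|grid_mode l t - grid_mode l u| =
  kap * lam ^+ l.1.1 * `|trig l.2 (2 ^+ l.1.1 * t ord0 l.1.2) -
    trig l.2 (2 ^+ l.1.1 * u ord0 l.1.2)|.
Proof.
by rewrite grid_modeB normrM gtr0_norm// mulr_gt0// exprn_gt0.
Qed.

Lemma grid_modeB_le l t u : `|grid_mode l t - grid_mode l u| <= 2 * kap.
Proof.
rewrite grid_modeB_norm mulrC ler_pM ?trig_dist_le2//.
  by rewrite mulr_ge0 ?exprn_ge0 ?ltW.
by rewrite ler_piMr ?(ltW kap_gt0)// exprn_ile1// ltW.
Qed.

Lemma sum_grid_modeB_le t u :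
  \sum_l `|grid_mode l t - grid_mode l u| <=
  rho / n%:R * enorm (t - u) `^ gamma.
Proof.
set r := enorm _ `^ _; have r0 : 0 <= r by exact: powR_ge0.
apply: (@le_trans _ _ (\sum_(l : L) 2 * kap * r * nu ^+ l.1.1)).
  apply: ler_sum => l _; rewrite grid_modeB_norm.
  apply: (@le_trans _ _ (kap * lam ^+ l.1.1 *
      (2 * ((2 `^ gamma) ^+ l.1.1 * r)))).
    rewrite ler_wpM2l//; first by rewrite mulr_ge0 ?exprn_ge0 ?ltW.
    apply: (le_trans (@trig_holder _ _ _ _ gamma _)); first by rewrite !ltW.
    rewrite -mulrBr normrM ger0_norm ?exprn_ge0// powRM ?exprn_ge0//.
    rewrite ler_pM2l//.
    rewrite powR_exprn// ler_pM2l ?exprn_gt0 ?powR_gt0//.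
    rewrite ge0_ler_powR ?nnegrE ?enorm_ge0 ?(ltW gamma_gt0)//.
    by rewrite -coordB coord_le_enorm.
  have -> : nu = lam * 2 `^ gamma.
    by rewrite /nu /lam -powRD ?pnatr_eq0 ?implybT// addrC.
  by rewrite exprMn le_eqVlt; apply/orP; left; apply/eqP; ring.
rewrite -mulr_sumr.
have -> : \sum_(l : L) nu ^+ l.1.1 = (2 * k%:R) * \sum_(j < J) nu ^+ j.
  rewrite -(pair_bigA _ (fun (p : 'I_J * 'I_k) (_ : bool) => nu ^+ p.1))/=.
  rewrite (eq_bigr (fun p : 'I_J * 'I_k => 2 * nu ^+ p.1)); last first.
    by move=> p _; rewrite sumr_const card_bool mulr_natl.
  rewrite -mulr_sumr -(pair_bigA _ (fun (j : 'I_J) (_ : 'I_k) => nu ^+ j))/=.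
  rewrite -mulrA; congr (_ * _); rewrite mulr_sumr; apply: eq_bigr => j _.
  by rewrite sumr_const card_ord mulr_natl.
apply: (@le_trans _ _ (2 * kap * r * (2 * k%:R * (1 - nu)^-1))).
  have kr : 0 <= 2 * kap * r by rewrite mulr_ge0// mulr_ge0// ltW.
  rewrite ler_wpM2l// ler_wpM2l//.
  by apply: sum_expr_le; rewrite ltW.
rewrite /grid_amplitude le_eqVlt; apply/orP; left; apply/eqP; field.
by rewrite !pnatr_eq0 -!lt0n n_gt0 k_gt0/= andbT subr_eq0 gt_eqF.
Qed.

Lemma grid_path_holder M (a : {ffun 'I_n -> {ffun L -> 'I_M}}) :
  holder0_ball gamma rho (grid_path a).
Proof.
apply/holder0_ballP => //; split.
  apply/rowP => i; rewrite !mxE big1// => l _.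
  by rewrite /grid_mode mxE mulr0 subrr mulr0 mul0r.
move=> t u _ _.
rewrite (_ : rho = n%:R * (rho / n%:R)); last first.
  by rewrite mulrC divfK// pnatr_eq0 -lt0n.
rewrite -mulrA; apply: enorm_le_card => i; rewrite coordB !mxE -sumrB.
apply: (le_trans (ler_norm_sum _ _ _)).
apply: le_trans (sum_grid_modeB_le t u); apply: ler_sum => l _.
rewrite -mulrBl normrM ler_piMr//.
have M0 : (0 < M)%N by apply: leq_ltn_trans (ltn_ord (a i l)).
rewrite ger0_norm ?divr_ge0// ler_pdivrMr ?ltr0n// mul1r ler_nat.
exact: ltnW.
Qed.

Variables (s d c0 : R) (M : nat).
Hypotheses (s0n : 0 < s < n%:R) (d_gt0 : 0 < d) (c0_gt0 : 0 < c0) (M_gt0 : (0 < M)%N).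
Hypothesis c0P : forall x y : R, 2^-1 <= `|x - y| <= 1 ->
  exists b, c0 <= `|trig b x - trig b y|.
Hypothesis dM : d `^ (- (s / n%:R)) <= M%:R * (2 * kap) `^ (- (s / n%:R)).

Definition grid_constant : R :=
  (2 * (1 + (1 - s / n%:R)^-1)) ^+ n * (kap * c0) `^ (- s).

Lemma grid_constant_ge0 : 0 <= grid_constant.
Proof.
have /andP[s0 sn] := s0n.
rewrite mulr_ge0 ?powR_ge0// exprn_ge0// mulr_ge0// addr_ge0// invr_ge0.
by rewrite subr_ge0 ler_pdivrMr ?mul1r ?ltW// (lt_trans s0).
Qed.

Lemma sum_grid_path_le (t u : 'rV[R]_k) (j : 'I_J) (i : 'I_k) :
  `|t ord0 i - u ord0 i| <= (2 ^+ j)^-1 ->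
  (2 ^+ j.+1)^-1 < `|t ord0 i - u ord0 i| ->
  \sum_(a : {ffun 'I_n -> {ffun L -> 'I_M}})
     reg_kernel s d (grid_path a t - grid_path a u) <=
  #|{ffun 'I_n -> {ffun L -> 'I_M}}|%:R *
    (grid_constant * (lam `^ (- s)) ^+ j).
Proof.
move=> tu1 tu2; have /andP[s0 sn] := s0n.
have j0 : 0 < 2 ^+ j :> R by rewrite exprn_gt0.
have [|b hb] := c0P (x := 2 ^+ j * t ord0 i) (y := 2 ^+ j * u ord0 i).
  rewrite -mulrBr normrM ger0_norm ?(ltW j0)//; apply/andP; split.
    move: tu2; rewrite exprS invfM => /ltW tu2.
    by rewrite -ler_pdivrMl// mulrC.
  by rewrite -ler_pdivlMl// mulr1.
(* The mode to average over: at frequency 2^j the phases in coordinate [i] differ by between 1/2 and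
   1, so sine or cosine separates them by [c0]. *)
pose l0 : L := (j, i, b).
pose c l := grid_mode l t - grid_mode l u.
have cl0 : kap * lam ^+ j * c0 <= `|c l0|.
  by rewrite /c grid_modeB_norm/= ler_wpM2l// mulr_ge0 ?exprn_ge0 ?ltW.
have w0 : 0 < kap * lam ^+ j * c0.
  by apply: mulr_gt0 => //; apply: mulr_gt0 => //; exact: exprn_gt0.
have c0' : 0 < `|c l0| by exact: lt_le_trans cl0.
rewrite (eq_bigr (fun a : {ffun 'I_n -> {ffun L -> 'I_M}} =>
  reg_kernel s d (\row_i \sum_l c l * ((a i l)%:R / M%:R)))); last first.
  move=> a _; congr reg_kernel; apply/rowP => i'; rewrite coordB !mxE -sumrB.
  by apply: eq_bigr => l _; rewrite mulrBl.
apply: (le_trans (sum_reg_kernel_grid_le (l0 := l0) s0n d_gt0 M_gt0 _ _)).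
- by rewrite -normr_gt0.
(* Mode increments never exceed 2 kap, so one grid size [M] serves all pairs [t], [u]. *)
- apply: (le_trans dM); rewrite ler_wpM2l//; apply: ler_powRN => //.
    by rewrite divr_ge0// ltW.
  exact: grid_modeB_le.
rewrite ler_wpM2l// /grid_constant -mulrA ler_wpM2l//.
  rewrite exprn_ge0// mulr_ge0// addr_ge0// invr_ge0.
  by rewrite subr_ge0 ler_pdivrMr ?mul1r ?ltW// (lt_trans s0).
apply: (le_trans (ler_powRN (ltW s0) w0 cl0)).
rewrite -(powR_exprn _ _ (ltW lam_gt0)).
have lj : 0 <= lam ^+ j by rewrite exprn_ge0 ?ltW.
have kc : 0 < kap * c0 by exact: mulr_gt0.
rewrite -powRM ?(ltW kc)//.
by rewrite -mulrA [lam ^+ j * c0]mulrC mulrA.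
Qed.

End grid_path.

(** * Integrating the averaged kernel; a path of finite energy *)

Section finite_energy.
Variables (R : realType) (k n : nat) (alpha gamma rho : R).
Hypotheses (k_gt0 : (0 < k)%N) (n_gt0 : (0 < n)%N) (rho_gt0 : 0 < rho).
Hypotheses (alpha_gt0 : 0 < alpha) (alpha_ltn : alpha < n%:R).
Hypotheses (gamma_gt0 : 0 < gamma) (gamma_lt1 : gamma < 1).
Hypothesis gamma_ltk : gamma < k%:R / (n%:R - alpha).

Local Notation P := (cube_measure R k).
Let s := n%:R - alpha.
Let s_gt0 : 0 < s. Proof. by rewrite subr_gt0. Qed.
Let s0n : 0 < s < n%:R. Proof. by rewrite s_gt0 gtrBl. Qed.

Lemma integral_close_pairs (c r : R) : 0 <= c -> 0 <= r ->
  (\int[P \x P]_z (c * \1_(close_pairs r) z)%:E <= (c * (2 * r) ^+ k)%:E)%E.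
Proof.
move=> c0 r0; under eq_integral do rewrite EFinM.
have m1 : measurable_fun setT
    (fun z : borel_rV R k * borel_rV R k => (\1_(close_pairs r) z)%:E : \bar R).
  apply/measurable_EFinP; apply: measurable_indic.
  exact: measurable_close_pairs.
rewrite (ge0_integralZl _ measurableT m1) ?lee_fin//.
rewrite integral_indic ?setIT//; last exact: measurable_close_pairs.
by rewrite EFinM lee_wpmul2l ?lee_fin// close_pairs_le.
Qed.

Lemma exists_reg_energy_bounded : exists w : R, forall d, 0 < d ->
  exists2 X : 'rV[R]_k -> 'rV[R]_n, holder0_ball gamma rho X &
    (reg_energy P alpha (X \o @clamp R k : borel_rV R k -> borel_rV R n) d
      <= w%:E)%E.
Proof.
(* Midway: g' > gamma gives Hoelder sums that converge, and g' s < k gives an integrable averaged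
   kernel. *)
pose g' := (gamma + k%:R / s) / 2.
have gg' : gamma < g' by rewrite ltr_pdivlMr// mulr_natr mulr2n ltrD2l.
have g's : g' * s < k%:R.
  by rewrite -ltr_pdivlMr// ltr_pdivrMr// mulr_natr mulr2n ltrD2r.
have [c0 c0_gt0 c0P] := trig_separation R.
pose lam : R := 2 `^ (- g').
pose kap : R := grid_amplitude k n gamma rho g'.
have kap0 : 0 < kap by exact: grid_amplitude_gt0.
pose Cst : R := grid_constant k n gamma rho g' s c0.
have Cst0 : 0 <= Cst by exact: grid_constant_ge0.
(* Equals 2^(g' s - k): from one scale to the next the kernel bound grows by 2^(g' s) while the
   measure bound for close pairs shrinks by 2^k. *)
pose q : R := lam `^ (- s) / 2 ^+ k.
have q01 : 0 <= q < 1.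
  rewrite divr_ge0 ?powR_ge0 ?exprn_ge0//= /q /lam -powRrM mulrNN.
  rewrite -powR_mulrn// -powRN -powRD ?pnatr_eq0 ?implybT//.
  by apply: powR2_lt1; rewrite subr_lt0.
exists ((2 * k%:R) ^+ k * (Cst * (1 - q)^-1 + 1)) => d d0.
pose ds := d `^ (- s).
have ds0 : 0 <= ds by exact: powR_ge0.
(* Then 2^J >= d^(-s). Pairs closer than all scales are estimated by the maximum d^(-s) of the
   kernel and contribute the summand 1 in the bound, which is thus independent of [d]. *)
pose J := (Num.truncn ds).+1.
pose b := s / n%:R.
pose M := (Num.truncn (d `^ (- b) * (2 * kap) `^ b)).+1.
have k20 : 0 < 2 * kap by rewrite mulr_gt0.
have dM : d `^ (- b) <= M%:R * (2 * kap) `^ (- b).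
  by rewrite [(2 * kap) `^ (- b)]powRN ler_pdivlMr ?powR_gt0// ltW// truncnS_gt.
pose S (j : nat) : set (borel_rV R k * borel_rV R k) := close_pairs (k%:R / 2 ^+ j).
(* A majorant of the averaged kernel: for each pair, one of its terms alone suffices. *)
pose W z := \sum_(j < J) (Cst * (lam `^ (- s)) ^+ j) * \1_(S j) z +
  ds * \1_(S J) z.
have cj0 j : 0 <= Cst * (lam `^ (- s)) ^+ j by rewrite mulr_ge0// exprn_ge0// powR_ge0.
have mS c j : measurable_fun setT (fun z => c * \1_(S j) z : R).
  apply: measurable_funM => //; apply: measurable_indic.
  exact: measurable_close_pairs.
have r0 (j : nat) : 0 <= k%:R / 2 ^+ j :> R by rewrite divr_ge0// exprn_ge0.
pose A := {ffun 'I_n -> {ffun 'I_J * 'I_k * bool -> 'I_M}}.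
pose X (a : A) := grid_path gamma rho g' a.
have hX (a : A) : holder0_ball gamma rho (X a).
  by apply: grid_path_holder.
have [|a|||z||a Ea] := @exists_reg_energy_le R n _ _ P alpha d
    ((2 * k%:R) ^+ k * (Cst * (1 - q)^-1 + 1)) A
    (fun a => X a \o @clamp R k : borel_rV R k -> borel_rV R n) W.
- apply/card_gt0P; exists [ffun=> [ffun=> ord0]]; by [].
- exact: (measurable_holder_clamp gamma_gt0 (ltW rho_gt0) (hX a)).
- by apply: measurable_funD => //; apply: measurable_sum => j.
- move=> z; rewrite addr_ge0// ?mulr_ge0// sumr_ge0// => j _.
  by rewrite mulr_ge0.
- set t := clamp z.1; set u := clamp z.2 => /=; rewrite -/t -/u.
  have tu1 i : `|(t - u) ord0 i| <= 1.
    have := @clamp_unit_cube _ _ z.1 i; have := @clamp_unit_cube _ _ z.2 i.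
    rewrite coordB !in_itv/= -/t -/u ler_norml => /andP[? ?] /andP[? ?].
    by apply/andP; split; lra.
  have inS (j : nat) : (forall i, `|(t - u) ord0 i| <= (2 ^+ j)^-1) ->
      \1_(S j) z = 1 :> R.
    by move=> tuj; rewrite indicE mem_set//; exact: enorm_le_card.
  have [far|[j [tuj [i iuj]]]] := dyadic_separation J tu1.
    apply: (@le_trans _ _ (\sum_(a : A) ds)).
      apply: ler_sum => a _; apply: ler_powRN => //; first exact: ltW.
      by rewrite lerDr enorm_ge0.
    rewrite sumr_const -[leLHS]mulr_natl ler_wpM2l// /W.
    by rewrite inS// mulr1 lerDr sumr_ge0// => j _; rewrite mulr_ge0.
  move: iuj (tuj i); rewrite coordB => iuj1 iuj2.
  apply: (le_trans (sum_grid_path_le k_gt0 n_gt0 rho_gt0 gamma_gt0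
    gg' s0n d0 c0_gt0 _ c0P dM iuj2 iuj1)) => //.
  rewrite ler_wpM2l// /W (bigD1 j)//= inS//.
  rewrite mulr1 -addrA lerDl addr_ge0 ?mulr_ge0//.
  by rewrite sumr_ge0// => j' _; rewrite mulr_ge0.
- rewrite /W; under eq_integral do rewrite EFinD -sumEFin.
  rewrite ge0_integralD//; last 4 first.
  - by move=> z _; apply: sume_ge0 => j _; rewrite lee_fin mulr_ge0.
  - by apply: emeasurable_sum => j; apply/measurable_EFinP.
  - by move=> z _; rewrite lee_fin mulr_ge0.
  - exact/measurable_EFinP.
  rewrite ge0_integral_sum//; last 2 first.
  - by move=> j; apply/measurable_EFinP.
  - by move=> j z _; rewrite lee_fin mulr_ge0.
  apply: (@le_trans _ _ (\sum_(j < J) (Cst * (lam `^ (- s)) ^+ j *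
      (2 * (k%:R / 2 ^+ j)) ^+ k)%:E + (ds * (2 * (k%:R / 2 ^+ J)) ^+ k)%:E)%E).
    by apply: leeD; [apply: lee_sum => j _|]; apply: integral_close_pairs.
  rewrite sumEFin -EFinD lee_fin mulrDr mulr1.
  have kj j : (2 * (k%:R / 2 ^+ j)) ^+ k = (2 * k%:R) ^+ k * ((2 ^+ k)^-1) ^+ j :> R.
    by rewrite mulrA exprMn !exprVn -!exprM mulnC.
  apply: lerD.
    rewrite (eq_bigr (fun j : 'I_J => (2 * k%:R) ^+ k * (Cst * q ^+ j))); last first.
      by move=> j _; rewrite kj /q [(_ / 2 ^+ k) ^+ j]exprMn mulrCA -!mulrA.
    rewrite -mulr_sumr ler_wpM2l ?exprn_ge0 ?mulr_ge0//.
    by rewrite -mulr_sumr ler_wpM2l// sum_expr_le.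
  rewrite kj mulrCA ler_piMr ?exprn_ge0 ?mulr_ge0// exprVn.
  rewrite ler_pdivrMr ?exprn_gt0// mul1r.
  apply: (le_trans (ltW (truncnS_gt ds))); rewrite -/J -exprM -natrX ler_nat.
  apply: (leq_trans (ltnW (ltn_expl J (ltnSn 1)))).
  by rewrite leq_exp2l// leq_pmull.
by exists (X a).
Qed.

Lemma exists_finite_riesz_energy : exists w : R,
  exists2 X : 'rV[R]_k -> 'rV[R]_n, holder0_ball gamma rho X &
    (riesz_energy alpha (occupation_measure X) <= w%:E)%E.
Proof.
have [w hw] := exists_reg_energy_bounded.
exists w; apply: riesz_energy_le_of_approx => //; first exact: ltW.
move=> e d e0 d0; have [X hX EX] := hw d d0; exists X => //.
by apply: (le_trans EX); rewrite lee_fin lerDl ltW.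
Qed.

End finite_energy.

(** * Images of rectangles, and the conclusion *)

Lemma cube_measure_box_gt0 (R : realType) (k : nat) (J : 'I_k -> interval R) :
  (forall i, (0 < lebesgue_measure [set` J i])%E) -> box J `<=` unit_cube ->
  (0 < cube_measure R k (box J))%E.
Proof.
move=> J0 Jc; rewrite cube_measureE setIidl// lebesgue_rV_box.
by apply: (big_ind (fun x => (0 < x)%E)) => //; exact: mule_gt0.
Qed.

(** The set lies in the image of the unit cube under an affine, hence Lipschitz, map, so
    [hausdorff_measure_holder] applies with exponent 1. *)
Lemma hausdorff_measure_bounded (R : realType) (n : nat) (A : set 'rV[R]_n)
    (B : R) : (0 < n)%N -> 0 < B ->
  (forall x i, A x -> `|x ord0 i| <= B) ->
  (hausdorff_measure n%:R A < +oo)%E.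
Proof.
move=> n0 B0 AB.
pose f (v : 'rV[R]_n) : 'rV[R]_n := \row_i (B * (2 * v ord0 i - 1)).
have hf t u : unit_cube t -> unit_cube u ->
    enorm (f t - f u) <= n%:R * (2 * B) * enorm (t - u) `^ 1.
  move=> _ _; rewrite powRr1 ?enorm_ge0// -mulrA; apply: enorm_le_card => i.
  rewrite coordB !mxE (_ : _ - _ = 2 * B * (t - u) ord0 i); last first.
    by rewrite coordB; ring.
  rewrite normrM ger0_norm ?mulr_ge0 ?(ltW B0)// ler_pM2l ?mulr_gt0//.
  exact: coord_le_enorm.
have C0 : 0 <= n%:R * (2 * B) by rewrite mulr_ge0// mulr_ge0// ltW.
have := hausdorff_measure_holder n0 C0 ltr01 hf; rewrite divr1.
apply: le_lt_trans; apply: le_hausdorff_measure => x Ax.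
exists (\row_i ((x ord0 i / B + 1) / 2)).
  move=> i; rewrite mxE in_itv/=.
  have : `|x ord0 i / B| <= 1.
    by rewrite normrM normfV (gtr0_norm B0) ler_pdivrMr// mul1r AB.
  by rewrite ler_norml => /andP[? ?]; apply/andP; split; lra.
by apply/rowP => i; rewrite !mxE; field; rewrite gt_eqF.
Qed.

Lemma hausdorff_measure_holder_ball (R : realType) (k n : nat) (gamma rho : R)
    (X : 'rV[R]_k -> 'rV[R]_n) (A : set 'rV[R]_k) :
  (0 < k)%N -> (0 < n)%N -> 0 < gamma -> 0 < rho ->
  holder0_ball gamma rho X -> A `<=` unit_cube ->
  (hausdorff_measure (Order.min (k%:R / gamma) n%:R)%R (X @` A) < +oo)%E.
Proof.
move=> k0 n0 g0 rho0 /(holder0_ballP _ _ g0)[X0 hX] Ac.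
rewrite minEle; case: ifPn => _.
  apply: (@le_lt_trans _ _ (hausdorff_measure (k%:R / gamma) (X @` unit_cube))).
    by apply: le_hausdorff_measure; exact: image_subset.
  exact: hausdorff_measure_holder (ltW rho0) g0 hX.
apply: (@hausdorff_measure_bounded _ _ _ (rho * k%:R `^ gamma)) => //.
  by rewrite mulr_gt0// powR_gt0// ltr0n.
move=> _ i [t /Ac ct <-]; apply: (le_trans (coord_le_enorm _ _)).
rewrite -[X t]subr0 -X0; apply: (le_trans (hX _ _ ct (@unit_cube0 _ _))).
rewrite ler_pM2l// ge0_ler_powR ?nnegrE ?enorm_ge0 ?(ltW g0)//.
rewrite -[leRHS]mulr1; apply: enorm_le_card => l; rewrite subr0.
by have := ct l; rewrite in_itv/= => /andP[? ?]; rewrite ger0_norm.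
Qed.

Theorem theorem2p1 (R : realType) (k n : nat) (alpha gamma rho : R)
    (k_ge1 : (1 <= k)%N) (n_ge1 : (1 <= n)%N)
    (alpha_gt0 : 0 < alpha) (alpha_ltn : alpha < n%:R)
    (gamma_gt0 : 0 < gamma)
    (gamma_lt : gamma < Order.min (k%:R / (n%:R - alpha)) 1)
    (rho_gt0 : 0 < rho) :
  let energy (X : 'rV[R]_k -> 'rV[R]_n) : \bar R :=
    riesz_energy alpha (occupation_measure X) in
  (exists X, minimizes energy (holder0_ball gamma rho) X) /\
  (forall (X : 'rV[R]_k -> 'rV[R]_n) (J : 'I_k -> interval R),
    minimizes energy (holder0_ball gamma rho) X ->
    (forall i, (0 < lebesgue_measure [set` J i])%E) ->
    box J `<=` unit_cube ->
    let d : R := Order.min (k%:R / gamma) n%:R in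
    [/\ hausdorff_measure (n%:R - alpha) (X @` box J) = +oo%E,
        (hausdorff_measure d (X @` box J) < +oo)%E,
        ((n%:R - alpha)%R%:E <= hausdorff_dim (X @` box J))%E &
        (hausdorff_dim (X @` box J) <= d%:E)%E]).
Proof.
move=> energy; move: gamma_lt; rewrite lt_min => /andP[gamma_ltk gamma_lt1].
have [w [Y hY Yw]] := exists_finite_riesz_energy k_ge1 n_ge1 rho_gt0 alpha_gt0
  alpha_ltn gamma_gt0 gamma_lt1 gamma_ltk.
split.
  apply: (exists_riesz_minimizer alpha_ltn gamma_gt0 (ltW rho_gt0)).
  by exists Y => //; exact: Yw.
move=> X J [hX Xmin] J0 Jc d.
have Hd : (hausdorff_measure d (X @` box J) < +oo)%E.
  exact: hausdorff_measure_holder_ball hX Jc.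
have Hs : hausdorff_measure (n%:R - alpha) (X @` box J) = +oo%E.
  have mX := measurable_holder_clamp gamma_gt0 (ltW rho_gt0) hX.
  have Xfin : (riesz_energy_prod (cube_measure R k) alpha
      (X \o @clamp R k : borel_rV R k -> borel_rV R n) < +oo)%E.
    rewrite -(riesz_energy_occupation alpha_ltn gamma_gt0 (ltW rho_gt0) hX).
    (* Comparison with the random-type path [Y] is the only use of minimality. *)
    by apply: (le_lt_trans (Xmin Y hY)); apply: (le_lt_trans Yw); exact: ltry.
  have := hausdorff_measure_finite_energy mX alpha_ltn Xfin
    (measurable_box J) (cube_measure_box_gt0 J0 Jc).
  congr (hausdorff_measure _ _ = _); apply/seteqP; split => [_ [t Jt <-]|_ [t Jt <-]].
    by exists t => //; rewrite /= clamp_id//; exact: Jc.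
  by exists t => //; rewrite /= clamp_id//; exact: Jc.
split => //; first exact: hausdorff_dim_ge.
apply: hausdorff_dim_le => //.
by rewrite le_min ler0n andbT divr_ge0// ltW.
Qed.
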